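(* Let $M=B\circ S$ with $S$ Poisson subsampling of rate $r$ and $B$ the Gaussian mechanism $B(y)=h(y)+V$, $h:\mathbb Y\to\mathbb R^D$, $V\sim\mathcal N(0,\sigma^2 I_D)$, $\sigma>0$. Let $L_2=\max_{y\simeq_\pm y'}\|h(y)-h(y')\|_2>0$. Then for all $x\simeq_{K_+,K_-}x'$, $$\Psi_\alpha(m_x\|m_{x'})\le\Psi_\alpha\Big(\sum_{i=1}^{K_-+1}f^{(1)}_i\,\mathrm{Binom}(i-1\mid K_-,r)\ \Big\|\ \sum_{j=1}^{K_++1}f^{(2)}_j\,\mathrm{Binom}(j-1\mid K_+,r)\Big),$$ where $f^{(1)}_i$ is the univariate normal density with mean $i-1$ and standard deviation $\sigma/L_2$, and $f^{(2)}_j$ is the univariate normal density with mean $-(j-1)$ and standard deviation $\sigma/L_2$.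
   Context: Finite set $\mathbb A$, datasets $x\subseteq\mathbb A$, batches are subsets $y\subseteq x$. Poisson subsampling with rate $r$: $s_x(y)=r^{|y|}(1-r)^{|x|-|y|}$ for $y\subseteq x$; $m_x(z)=\sum_y b_y(z)s_x(y)$ where $b_y$ is the density of $B(y)$. $y\simeq_\pm y'$ iff one is obtained from the other by inserting or removing a single element. $x\simeq_{K_+,K_-}x'$ iff $x'=(x\setminus g_-)\cup g_+$ with $g_-\subseteq x$, $|g_-|=K_-$, $g_+\cap x=\emptyset$, $|g_+|=K_+$. $\mathrm{Binom}(k\mid n,r)=\binom nk r^k(1-r)^{n-k}$. $H_\alpha(p\|q)=\int\max\{p-\alpha q,0\}$ ($\alpha\ge0$), $\Lambda_\alpha(p\|q)=\int p^\alpha q^{1-\alpha}$ ($\alpha>1$); $\Psi_\alpha$ is either. *)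

(* Defs.v *)
From HB Require Import structures.
From mathcomp Require Import all_boot all_order all_algebra.
From mathcomp Require Import all_classical all_reals all_analysis.
From mathcomp Require Import normal_distribution binomial_distribution.
Set Implicit Arguments. Unset Strict Implicit. Unset Printing Implicit Defensive.
Import Order.TTheory GRing.Theory Num.Theory.
Local Open Scope ring_scope.

Section Defs.
Context {R : realType} {A : finType}.

Definition poisson_sub (r : R) (x y : {set A}) : R :=
  if y \subset x then r ^+ #|y| * (1 - r) ^+ (#|x| - #|y|) else 0.

Definition batch_adj (y y' : {set A}) : Prop :=
  exists a : A, (a \notin y /\ y' = a |: y) \/ (a \notin y' /\ y = a |: y').

Definition dataset_rel (Kp Km : nat) (x x' : {set A}) : Prop :=
  exists gm gp : {set A},
    [/\ gm \subset x, #|gm| = Km, [disjoint gp & x], #|gp| = Kp &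
        x' = (x :\: gm) :|: gp].

Definition norm2 (D : nat) (v : 'rV[R]_D) : R :=
  Num.sqrt (\sum_(i < D) v ord0 i ^+ 2).

(* L2 = max_{y ≃± y'} ||h y - h y'||_2  (finite max; norms are >= 0) *)
Definition L2sens (D : nat) (h : {set A} -> 'rV[R]_D) : R :=
  \big[Num.max/0]_(y : {set A})
    \big[Num.max/0]_(y' : {set A} | `[< batch_adj y y' >])
      norm2 (h y - h y').

Definition gauss_density (D : nat) (h : {set A} -> 'rV[R]_D) (sigma : R)
    (y : {set A}) (z : 'rV[R]_D) : R :=
  \prod_(i < D) normal_pdf (h y ord0 i) sigma (z ord0 i).

Definition mix_density (D : nat) (h : {set A} -> 'rV[R]_D) (sigma r : R)
    (x : {set A}) (z : 'rV[R]_D) : R :=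
  \sum_(y : {set A}) gauss_density h sigma y z * poisson_sub r x y.

End Defs.

Inductive divergence := Hockey | Renyi.

Definition psi_integrand {R : realType} (k : divergence) (alpha p q : R)
  : \bar R :=
  match k with
  | Hockey => (Num.max (p - alpha * q) 0)%:E
  | Renyi => (powR p alpha * powR q (1 - alpha))%:E
  end.

Definition psi_admissible {R : realType} (k : divergence) (alpha : R) : Prop :=
  match k with
  | Hockey => 0 <= alpha
  | Renyi => 1 < alpha
  end.

(* Iterated Lebesgue integral over coordinates 0..n-1 (others set to 0).
   For nonnegative measurable integrands this is the Lebesgue integral on
   R^n by Tonelli. *)
Fixpoint iint {R : realType} (n : nat) (F : (nat -> R) -> \bar R) : \bar R :=
  match n with
  | 0 => F (fun _ => 0)
  | n'.+1 => (\int[@lebesgue_measure R]_t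
                 iint n' (fun v => F (fun k => if k == n' then t else v k)))%E
  end.

Definition int_RD {R : realType} (D : nat) (F : 'rV[R]_D -> \bar R) : \bar R :=
  iint D (fun v => F (\row_(i < D) v (nat_of_ord i))).

Definition PsiD {R : realType} (k : divergence) (alpha : R) (D : nat)
    (p q : 'rV[R]_D -> R) : \bar R :=
  int_RD (fun z => psi_integrand k alpha (p z) (q z)).

Definition Psi1 {R : realType} (k : divergence) (alpha : R) (p q : R -> R)
  : \bar R :=
  (\int[@lebesgue_measure R]_t psi_integrand k alpha (p t) (q t))%E.

(* Main.v *)
(** Proof idea.  Write [x = C u gm] and [x' = C u gp] with [C] the common part.
    Both mixtures are averages, with the same weights over [c <= C], of Gaussian
    mixtures with means [h (c u U)], [U <= gm], resp. [h (c u W)], [W <= gp], and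
    these means lie at distance at most [#|U| L2], resp. [#|W| L2], from [h c].

    In the univariate problem, dividing by the Gaussian density common to both
    sides makes every component of the first mixture increasing and every
    component of the second one decreasing in [t].  If [p - alpha q] vanishes at
    [t0], its positive part is therefore the sum of the positive parts of the
    components minus their values at [t0] (comonotonicity).  In dimension [D] the
    same constants give an upper bound by subadditivity of the positive part.
    It remains to compare two single Gaussians: by rotation invariance
    [int (c1 N(m1) - c2 N(m2))_+] only depends on [|m1 - m2|], and by Jensen's
    inequality it is nondecreasing in [|m1 - m2|].  When there is no zero [t0], the
    bound is applied along [t0 -> -oo] or [t0 -> +oo].

    The Renyi case follows because [p^alpha q^(1 - alpha)] is a mixture of the
    integrands [(p - e^-y q)_+], with weights that depend on [alpha] only. *)
Require Import Defs.
From HB Require Import structures.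
From mathcomp Require Import all_boot all_order all_algebra.
From mathcomp Require Import all_classical all_reals all_analysis.
From mathcomp Require Import normal_distribution binomial_distribution.
From mathcomp Require Import exponential_distribution measurable_realfun.
From mathcomp Require Import ring lra zify.
Import Order.TTheory GRing.Theory Num.Theory.
Import numFieldNormedType.Exports.
Local Open Scope ring_scope.
Set Implicit Arguments.
Unset Strict Implicit.
Unset Printing Implicit Defensive.

(** * Affine changes of variables *)

Section affine.
Local Open Scope classical_set_scope.
Context {R : realType}.
Local Notation mu := (@lebesgue_measure R).

Lemma measurable_affine (a b : R) : measurable_fun setT (fun t : R => a * t + b).
Proof.
apply: continuous_measurable_fun => x; apply: cvgD; last exact: cvg_cst.
by apply: cvgM; [exact: cvg_cst|exact: cvg_id].
Qed.

Lemma affine_preimage_itv (a b x y : R) : 0 < a ->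
  (fun t : R => a * t + b) @^-1` `]x, y]%classic = `](x - b) / a, (y - b) / a]%classic.
Proof.
move=> a0; apply/seteqP; split => t /=; rewrite !in_itv/= ltr_pdivrMr// ler_pdivlMr//.
  by rewrite ltrBlDr lerBrDr (mulrC t).
by rewrite ltrBlDr lerBrDr (mulrC t).
Qed.

Let affine_image (a b : R) : {measure set (measurableTypeR R) -> \bar R}.
Proof.
by refine (pushforward mu (fun t : R => (a * t + b)%R : measurableTypeR R));
  exact: measurable_affine.
Defined.

(** Both measures agree on the intervals []x, y]], which characterises the Lebesgue measure. *)
Lemma lebesgue_measure_affine_pos (a b : R) (A : set R) (a0 : 0 < a) : measurable A ->
  mscale (NngNum (ltW a0)) (affine_image a b) A = mu A.
Proof.
move=> mA; apply/esym/lebesgue_measure_unique => //= _ [[x y]] _ <-.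
rewrite /mscale/= /pushforward affine_preimage_itv//.
rewrite !lebesgue_measure_itv/= !lte_fin.
rewrite ltr_pdivrMr// divfK ?gt_eqF// ltrD2r.
case: ifPn; last by rewrite mule0.
move=> xy; rewrite -EFinD -EFinD -EFinM; congr (_%:E).
by field; rewrite gt_eqF.
Qed.

Lemma ge0_integral_affine_pos (a b : R) (f : R -> \bar R) : 0 < a ->
  measurable_fun setT f -> (forall t, (0 <= f t)%E) ->
  (\int[mu]_t f t = \int[mu]_t (a%:E * f (a * t + b)%R))%E.
Proof.
move=> a0 mf f0.
transitivity (\int[mscale (NngNum (ltW a0)) (affine_image a b)]_t f t)%E.
  apply: eq_measure_integral => A mA _.
  exact/esym/lebesgue_measure_affine_pos.
rewrite ge0_integral_mscale//= ge0_integral_pushforward//; last first.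
  exact: measurable_affine.
rewrite preimage_setT ge0_integralZl//=.
- by apply: measurableT_comp => //; exact: measurable_affine.
- by rewrite lee_fin ltW.
Qed.

Lemma ge0_integral_oppr (f : R -> \bar R) :
  measurable_fun setT f -> (forall t, (0 <= f t)%E) ->
  (\int[mu]_t f t = \int[mu]_t f (- (t : R))%R)%E.
Proof.
move=> mf f0.
transitivity (\int[pushforward mu (-%R : _ -> measurableTypeR R)]_t f t)%E.
  apply: eq_measure_integral => A mA _.
  exact/esym/lebesgue_measureN.
by rewrite ge0_integral_pushforward// preimage_setT.
Qed.

Lemma ge0_integral_affine (a b : R) (f : R -> \bar R) : a != 0 ->
  measurable_fun setT f -> (forall t, (0 <= f t)%E) ->
  (\int[mu]_t f t = \int[mu]_t (`|a|%:E * f (a * t + b)%R))%E.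
Proof.
move=> a0 mf f0; case: (ltrgt0P a) => [ap|an|aE].
- exact: ge0_integral_affine_pos.
- rewrite (@ge0_integral_affine_pos (- a) b)// ?oppr_gt0// ge0_integral_oppr//.
  + by apply: eq_integral => t _; rewrite mulNr mulrN opprK.
  + apply: emeasurable_funM => //.
    by apply: measurableT_comp => //; exact: measurable_affine.
  + by move=> t; rewrite mule_ge0// lee_fin oppr_ge0 ltW.
- by rewrite aE eqxx in a0.
Qed.
End affine.

(** * Rotation invariance of the Gaussian measure *)

Section gauss.
Context {R : realType}.
Local Notation mu := (@lebesgue_measure R).
Local Notation phi := (@normal_pdf R 0 1).

(** The likelihood ratio of N(d, 1) against N(0, 1) at [t]. *)
Definition lratio (d t : R) : R := expR (d * t - d ^+ 2 / 2).

Lemma lratio_gt0 d t : 0 < lratio d t. Proof. exact: expR_gt0. Qed.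

Lemma measurable_lratio d : measurable_fun setT (lratio d).
Proof.
by apply: measurableT_comp => //; apply: measurable_funB.
Qed.

Lemma lratio0 t : lratio 0 t = 1.
Proof. by rewrite /lratio mul0r expr0n/= mul0r subr0 expR0. Qed.

Lemma normal_peakE (s : R) : 0 < s -> normal_peak s = normal_peak 1 / s.
Proof.
move=> s0; rewrite /normal_peak expr1n mul1r -mulrnAr sqrtrM ?sqr_ge0//.
by rewrite sqrtr_sqr gtr0_norm// invfM mulrC.
Qed.

Lemma phiE t : phi t = normal_peak 1 * expR (- t ^+ 2 / 2).
Proof.
by rewrite normal_pdfE ?oner_neq0// /normal_fun subr0 expr1n.
Qed.

Lemma phi_ge0 t : 0 <= phi t. Proof. exact: normal_pdf_ge0. Qed.

Lemma measurable_phi : measurable_fun setT phi.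
Proof. exact: measurable_normal_pdf. Qed.

Lemma normal_pdf_affine m s d t : 0 < s ->
  s * normal_pdf (m + s * d) s (m + s * t) = phi t * lratio d t.
Proof.
move=> s0; rewrite normal_pdfE ?gt_eqF// normal_peakE// phiE /normal_fun /lratio.
rewrite -[RHS]mulrA -expRD mulrA [s * (_ / s)]mulrC divfK ?gt_eqF//.
congr (_ * expR _).
by field; rewrite gt_eqF.
Qed.

(** In the coordinates (u, w) with s w = e u + d t, the joint density of two independent standard
    normals u and t factors into the conditional density of u given w, which is N(e w / s, (d /
    s)^2), and the marginal density of w. The factor [|s / d|] is the Jacobian. *)
Lemma rotation_density (d e s u w : R) : d != 0 -> s != 0 ->
  s ^+ 2 = d ^+ 2 + e ^+ 2 ->
  `|s / d| * (phi u * phi (s / d * w + - (e * u) / d)) =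
  normal_pdf (e * w / s) `|d / s| u * phi w.
Proof.
move=> d0 s0 sde; rewrite !phiE.
rewrite normal_pdfE; last by rewrite normr_eq0 mulf_neq0// invr_eq0.
rewrite (@normal_peakE `|d / s|); last by rewrite normr_gt0 mulf_neq0// invr_eq0.
rewrite /normal_fun real_normK ?num_real//.
rewrite -(invf_div s d) normfV invrK.
set X := expR _; set Y := expR _; set X' := expR _; set Y' := expR _.
suff XY : X * Y = X' * Y'.
  transitivity (`|s / d| * normal_peak 1 ^+ 2 * (X * Y)); first by ring.
  by rewrite XY; ring.
rewrite /X /Y /X' /Y' -!expRD; congr expR.
have e2 : e ^+ 2 = s ^+ 2 - d ^+ 2 by rewrite sde addrC addKr.
apply/eqP; rewrite -subr_eq0; apply/eqP.
(* The difference of the two exponents is a multiple of s^2 - d^2 - e^2. *)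
transitivity ((s ^+ 2 - d ^+ 2 - e ^+ 2) *
  (w ^+ 2 - u ^+ 2) / (- 2 * d ^+ 2)).
  by field; rewrite d0 s0.
by rewrite e2 subrr !mul0r.
Qed.

Lemma rotation_arg (d e s u w : R) : d != 0 ->
  e * u + d * (s / d * w + - (e * u) / d) = s * w.
Proof. by move=> d0; field. Qed.

(** For independent standard normals u and t, e u + d t has the law of s t. The inner variable is
    changed to the w of [rotation_density]; after Tonelli the conditional density of u integrates to
    1. *)
Lemma normal_rotation (d e s : R) (F : R -> \bar R) : s ^+ 2 = d ^+ 2 + e ^+ 2 ->
  measurable_fun setT F -> (forall x, (0 <= F x)%E) ->
  (\int[mu]_u \int[mu]_t ((phi u * phi t)%:E * F (e * u + d * t)%R)
   = \int[mu]_t ((phi t)%:E * F (s * t)%R))%E.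
Proof.
move=> sde mF F0.
(* At [d = 0] the substitution degenerates, but then [s] is [e] or [- e], and [phi] is even. *)
have [d0|d0] := eqVneq d 0.
  transitivity (\int[mu]_u ((phi u)%:E * F (e * u)%R))%E.
    apply: eq_integral => u _.
    transitivity (\int[mu]_t ((phi t)%:E * ((phi u)%:E * F (e * u)%R)))%E.
      by apply: eq_integral => t _; rewrite d0 mul0r addr0 muleA -EFinM mulrC.
    rewrite ge0_integralZr//; last 3 first.
    - by apply/measurable_EFinP; exact: measurable_phi.
    - by move=> t _; rewrite lee_fin phi_ge0.
    - by rewrite mule_ge0// lee_fin phi_ge0.
    by rewrite integral_normal_pdf mul1e.
  have /eqP : s ^+ 2 = e ^+ 2 by rewrite sde d0 expr0n/= add0r.
  rewrite eqf_sqr => /orP[/eqP ->//|/eqP ->].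
  pose g (t : R) := ((phi t)%:E * F (- e * t)%R)%E.
  have mg : measurable_fun setT g.
    apply: emeasurable_funM; first by apply/measurable_EFinP; exact: measurable_phi.
    by apply: measurableT_comp => //; exact: measurable_funM.
  have g0 t : (0 <= g t)%E by rewrite mule_ge0// lee_fin phi_ge0.
  rewrite [RHS](ge0_integral_oppr mg g0).
  apply: eq_integral => t _; rewrite /g !phiE sqrrN.
  by rewrite (mulNr e) mulrN opprK.
have s0 : s != 0.
  by rewrite -sqrf_eq0 sde gt_eqF// ltr_wpDr ?sqr_ge0// exprn_even_gt0.
have sd0 : s / d != 0 by rewrite mulf_neq0// invr_eq0.
pose G (z : R * R) : \bar R :=
  ((`|s / d| * (phi z.1 * phi (s / d * z.2 + - (e * z.1) / d)))%:E * F (s * z.2)%R)%E.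
have mG : measurable_fun setT G.
  apply: emeasurable_funM.
    apply/measurable_EFinP; apply: measurable_funM => //.
    apply: measurable_funM.
      apply: measurableT_comp => //; exact: measurable_phi.
    apply: (measurableT_comp measurable_phi).
    apply: measurable_funD; first exact: measurable_funM.
    apply: measurable_funM => //; apply: measurableT_comp => //.
    exact: measurable_funM.
  by apply: measurableT_comp => //; exact: measurable_funM.
have G0 z : (0 <= G z)%E.
  by rewrite mule_ge0// lee_fin !mulr_ge0// phi_ge0.
transitivity (\int[mu]_u \int[mu]_w G (u, w))%E.
  apply: eq_integral => u _.
  rewrite (@ge0_integral_affine _ (s / d) (- (e * u) / d))//; first last.
  - by move=> t; rewrite mule_ge0// lee_fin mulr_ge0// phi_ge0.
  - apply: emeasurable_funM.
      apply/measurable_EFinP; apply: measurable_funM => //; exact: measurable_phi.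
    by apply: measurableT_comp => //; apply: measurable_funD.
  apply: eq_integral => w _; rewrite muleA -EFinM.
  by rewrite (rotation_arg e s u w d0).
rewrite fubini_tonelli//; apply: eq_integral => w _.
transitivity (\int[mu]_u ((normal_pdf (e * w / s) `|d / s| u)%:E
                           * ((phi w)%:E * F (s * w)%R)))%E.
  apply: eq_integral => u _; rewrite muleA -EFinM.
  by rewrite -(rotation_density u w d0 s0 sde).
rewrite ge0_integralZr//; first last.
- by rewrite mule_ge0// lee_fin phi_ge0.
- by move=> t _; rewrite lee_fin normal_pdf_ge0.
- by apply/measurable_EFinP; exact: measurable_normal_pdf.
by rewrite integral_normal_pdf mul1e.
Qed.
End gauss.

(** * Gaussian hinge integrals *)

Section hinge.
Context {R : realType}.
Local Notation mu := (@lebesgue_measure R).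
Local Notation phi := (@normal_pdf R 0 1).

(** By [phi_lratio] below, this integrates the positive part of c1 N(d, 1) - c2 N(0, 1): two
    Gaussians at standardised distance [d]. The coefficients may be negative, as they are for the
    components of the second mixture. *)
Definition hinge (d c1 c2 : R) : \bar R :=
  (\int[mu]_t (phi t * Num.max (c1 * lratio d t - c2) 0)%:E)%E.

Lemma phi_lratio (d t : R) : phi t * lratio d t = normal_pdf d 1 t.
Proof.
by rewrite -(normal_pdf_affine 0 d t (@ltr01 R)) !mul1r !add0r.
Qed.

Lemma integrable_phi_lratio (d c : R) :
  mu.-integrable setT (fun t => (phi t * (c * lratio d t))%:E).
Proof.
rewrite (_ : (fun _ => _) = (fun t => c%:E * (normal_pdf d 1 t)%:E)%E).
  by apply: integrableZl => //; exact: integrable_normal_pdf.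
by apply/funext => t; rewrite -EFinM -(phi_lratio d) mulrCA.
Qed.

Lemma integral_phi_lratio (d c : R) :
  (\int[mu]_t (phi t * (c * lratio d t))%:E = c%:E)%E.
Proof.
transitivity (\int[mu]_t (c%:E * (normal_pdf d 1 t)%:E))%E.
  by apply: eq_integral => t _; rewrite -EFinM -(phi_lratio d) mulrCA.
rewrite integralZl//; last exact: integrable_normal_pdf.
by rewrite integral_normal_pdf mule1.
Qed.

Lemma measurable_hinge_fun (d c1 c2 : R) :
  measurable_fun setT (fun t => (phi t * Num.max (c1 * lratio d t - c2) 0)).
Proof.
apply: measurable_funM; first exact: measurable_phi.
apply: measurable_maxr => //; apply: measurable_funB => //.
by apply: measurable_funM => //; exact: measurable_lratio.
Qed.

Lemma hinge_fun_ge0 (d c1 c2 t : R) :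
  0 <= phi t * Num.max (c1 * lratio d t - c2) 0.
Proof. by rewrite mulr_ge0 ?phi_ge0// le_max lexx orbT. Qed.

Lemma integrable_hinge_fun (d c1 c2 : R) : mu.-integrable setT
  (fun t => (phi t * Num.max (c1 * lratio d t - c2) 0)%:E).
Proof.
apply/integrableP; split.
  by apply/measurable_EFinP; exact: measurable_hinge_fun.
(* The factor [lratio 0] equals 1 and brings the constant term into the form of
   [integrable_phi_lratio]. *)
apply: (@le_lt_trans _ _ (\int[mu]_t ((phi t * (`|c1| * lratio d t))%:E
                               + (phi t * (`|c2| * lratio 0 t))%:E))%E).
  apply: ge0_le_integral => //=.
  + by apply/measurable_EFinP; apply: measurableT_comp => //;
      exact: measurable_hinge_fun.
  + apply: emeasurable_funD; apply: (measurable_int mu);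
      exact: integrable_phi_lratio.
  + move=> t _; rewrite lee_fin ger0_norm ?hinge_fun_ge0// -mulrDr.
    rewrite ler_wpM2l ?phi_ge0// lratio0 mulr1 ge_max; apply/andP; split.
      rewrite (le_trans (ler_norm _))// (le_trans (ler_normB _ _))//.
      by rewrite normrM (gtr0_norm (lratio_gt0 _ _)).
    by rewrite addr_ge0// mulr_ge0// ltW// lratio_gt0.
rewrite integralD//=; [|exact: integrable_phi_lratio..].
by rewrite !integral_phi_lratio -EFinD ltry.
Qed.

Lemma hinge_fin_num (d c1 c2 : R) : hinge d c1 c2 \is a fin_num.
Proof. exact: integrable_fin_num (integrable_hinge_fun d c1 c2). Qed.

(** Under the standard Gaussian, [lratio d] has mean 1, so [c1 * lratio d - c2] has mean [c1 - c2];
    its positive part dominates both it and 0. *)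
Lemma hinge_jensen (d c1 c2 : R) : ((Num.max (c1 - c2) 0)%:E <= hinge d c1 c2)%E.
Proof.
have h0 : (0 <= hinge d c1 c2)%E.
  by apply: integral_ge0 => t _; rewrite lee_fin hinge_fun_ge0.
have h1 : ((c1 - c2)%:E <= hinge d c1 c2)%E.
  have -> : ((c1 - c2)%:E = \int[mu]_t ((phi t * (c1 * lratio d t))%:E
                                   - (phi t * (c2 * lratio 0 t))%:E))%E.
    rewrite integralB//=; [|exact: integrable_phi_lratio..].
    by rewrite !integral_phi_lratio.
  apply: le_integral => //.
  - by apply: integrableB => //; exact: integrable_phi_lratio.
  - exact: integrable_hinge_fun.
  - move=> t _ /=; rewrite -EFinD lee_fin lratio0 mulr1 -mulrBr.
    by rewrite ler_wpM2l ?phi_ge0// le_max lexx.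
by case: (leP (c1 - c2) 0).
Qed.

(** The product [lratio e u * lratio d t] depends on e u + d t only, because the quadratic terms add
    up to s^2; hence [normal_rotation] applies. *)
Lemma hinge_rotation (d e s c1 c2 : R) : s ^+ 2 = d ^+ 2 + e ^+ 2 ->
  (\int[mu]_u ((phi u)%:E * hinge d (c1 * lratio e u) c2) = hinge s c1 c2)%E.
Proof.
move=> sde.
pose F (x : R) := (Num.max (c1 * expR (x - s ^+ 2 / 2) - c2) 0)%:E.
have mF : measurable_fun setT F.
  apply/measurable_EFinP; apply: measurable_maxr => //.
  apply: measurable_funB => //; apply: measurable_funM => //.
  by apply: measurableT_comp => //; apply: measurable_funB.
have F0 x : (0 <= F x)%E by rewrite lee_fin le_max lexx orbT.
transitivity (\int[mu]_t ((phi t)%:E * F (s * t)%R))%E; last first.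
  by apply: eq_integral => t _; rewrite /F -EFinM.
rewrite -(normal_rotation sde)//; apply: eq_integral => u _.
rewrite /hinge -ge0_integralZl//=; first last.
- by rewrite lee_fin phi_ge0.
- by move=> t _; rewrite lee_fin hinge_fun_ge0.
- by apply/measurable_EFinP; exact: measurable_hinge_fun.
apply: eq_integral => t _; rewrite /F -!EFinM mulrA; congr ((_ * Num.max (_ - _) _)%:E).
rewrite -mulrA /lratio -expRD; congr (_ * expR _).
by rewrite sde; field.
Qed.

(** Split the shift [s] into [d] and an orthogonal remainder. Jensen in the remaining direction
    bounds the inner integral from below by the integrand of [hinge d]. *)
Lemma hinge_le (d s c1 c2 : R) : d ^+ 2 <= s ^+ 2 ->
  (hinge d c1 c2 <= hinge s c1 c2)%E.
Proof.
move=> ds; have sE : s ^+ 2 = Num.sqrt (s ^+ 2 - d ^+ 2) ^+ 2 + d ^+ 2.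
  by rewrite sqr_sqrtr ?subr_ge0// subrK.
rewrite -(hinge_rotation c1 c2 sE); set e := Num.sqrt _.
apply: ge0_le_integral => //=.
- by move=> t _; rewrite lee_fin hinge_fun_ge0.
- by apply/measurable_EFinP; exact: measurable_hinge_fun.
- apply: emeasurable_funM; first by apply/measurable_EFinP; exact: measurable_phi.
  pose f (z : R * R) := (phi z.2 * Num.max (c1 * lratio d z.1 * lratio e z.2 - c2) 0)%:E.
  apply: (@measurable_fun_fubini_tonelli_F _ _ _ _ _ mu f).
  + apply/measurable_EFinP; apply: measurable_funM.
      by apply: measurableT_comp => //; exact: measurable_phi.
    apply: measurable_maxr => //; apply: measurable_funB => //.
    apply: measurable_funM.
      apply: measurable_funM => //; apply: measurableT_comp => //.
      exact: measurable_lratio.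
    by apply: measurableT_comp => //; exact: measurable_lratio.
  + by move=> z; rewrite lee_fin hinge_fun_ge0.
- move=> t _; rewrite EFinM lee_wpmul2l ?lee_fin ?phi_ge0//.
  exact: hinge_jensen.
Qed.

Lemma density_at (m1 m2 t sigma : R) : 0 < sigma ->
  sigma * normal_pdf m1 sigma (sigma * t + m2) =
  phi t * lratio ((m1 - m2) / sigma) t.
Proof.
move=> s0; rewrite -(normal_pdf_affine m2 _ t s0) [sigma * t + m2]addrC.
have -> // : m2 + sigma * ((m1 - m2) / sigma) = m1.
by field; rewrite gt_eqF.
Qed.

End hinge.

(** * Iterated integrals *)

Section iterated_integral.
Context {R : realType}.
Local Notation mu := (@lebesgue_measure R).

(* The space [nat -> R] carries no sigma-algebra here: measurability of a
   parametrised integrand is tested along all measurable parametrisations. *)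
Definition coord_measurable d (T : measurableType d)
    (G : T -> (nat -> R) -> \bar R) : Prop :=
  forall d' (S : measurableType d') (tau : S -> T) (g : nat -> S -> R),
    measurable_fun setT tau -> (forall k, measurable_fun setT (g k)) ->
    measurable_fun setT (fun s => G (tau s) (fun k => g k s)).

Definition slice (n : nat) (t : R) (v : nat -> R) : nat -> R :=
  fun k => if k == n then t else v k.

Lemma iintS n (F : (nat -> R) -> \bar R) :
  iint n.+1 F = (\int[mu]_t iint n (fun v => F (slice n t v)))%E.
Proof. by []. Qed.

Lemma coord_measurable_slice n d (T : measurableType d)
    (G : T -> (nat -> R) -> \bar R) : coord_measurable G ->
  coord_measurable (fun (p : T * R) v => G p.1 (slice n p.2 v)).
Proof.
move=> mG d' S tau g mtau mg /=.
apply: (mG d' S (fun s => (tau s).1) (fun k s => slice n (tau s).2 (fun k => g k s) k)).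
  exact: measurableT_comp.
move=> k; rewrite /slice; case: (k == n) => //.
exact: measurableT_comp.
Qed.

Lemma coord_measurable_at d (T : measurableType d) d' (T' : measurableType d')
    (f : T' -> T) (G : T -> (nat -> R) -> \bar R) :
  measurable_fun setT f -> coord_measurable G ->
  coord_measurable (fun p => G (f p)).
Proof.
move=> mf mG d0 S tau g mtau mg; apply: (mG _ _ (f \o tau)) => //.
exact: measurableT_comp.
Qed.

Lemma iint_ge0 n (F : (nat -> R) -> \bar R) :
  (forall v, (0 <= F v)%E) -> (0 <= iint n F)%E.
Proof.
elim: n F => [|n IH] F F0; first exact: F0.
by apply: integral_ge0 => t _; apply: IH => v; exact: F0.
Qed.

(** The induction generalises the parameter space: the outermost coordinate joins the parameter in
    [T * R], and Tonelli gives measurability of the integral over it. *)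
Lemma measurable_iint n d (T : measurableType d) (G : T -> (nat -> R) -> \bar R) :
  coord_measurable G -> (forall p v, (0 <= G p v)%E) ->
  measurable_fun setT (fun p => iint n (G p)).
Proof.
elim: n d T G => [|n IH] d T G mG G0.
  exact: (mG _ _ id (fun _ _ => 0)).
apply: (@measurable_fun_fubini_tonelli_F _ _ _ _ _ mu
  (fun p : T * R => iint n (fun v => G p.1 (slice n p.2 v)))).
- apply: (IH _ _ (fun p v => G p.1 (slice n p.2 v))) => //.
  exact: coord_measurable_slice.
- by move=> p; exact: iint_ge0.
Qed.

(** The case without parameter, phrased with a dummy parameter in [R] so that the parametrised
    lemmas apply. *)
Definition cmeas (F : (nat -> R) -> \bar R) : Prop :=
  coord_measurable (fun _ : R => F).

Lemma cmeas_slice n (F : (nat -> R) -> \bar R) : cmeas F ->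
  coord_measurable (fun t v => F (slice n t v)).
Proof.
move=> mF; have := coord_measurable_slice n mF.
apply: (@coord_measurable_at _ (R * R)%type _ R (fun t => (t, t))).
exact: measurable_fun_pair.
Qed.

Lemma coord_measurable_cmeas d (T : measurableType d) (G : T -> (nat -> R) -> \bar R) p :
  coord_measurable G -> cmeas (G p).
Proof. by move=> mG; apply: (coord_measurable_at (f := fun=> p)). Qed.

Lemma le_iint n (F G : (nat -> R) -> \bar R) : cmeas F -> cmeas G ->
  (forall v, (0 <= F v)%E) -> (forall v, (F v <= G v)%E) ->
  (iint n F <= iint n G)%E.
Proof.
elim: n F G => [|n IH] F G mF mG F0 FG; first exact: FG.
rewrite !iintS; apply: ge0_le_integral => //.
- by move=> t _; exact: iint_ge0.
- by apply: (@measurable_iint n _ R) => //; exact: cmeas_slice.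
- apply: (@measurable_iint n _ R); first exact: cmeas_slice.
  by move=> t v; exact: le_trans (FG _).
- move=> t _; apply: IH => //.
  + exact: (coord_measurable_cmeas t (cmeas_slice n mF)).
  + exact: (coord_measurable_cmeas t (cmeas_slice n mG)).
Qed.

Lemma eq_iint n (F G : (nat -> R) -> \bar R) : F =1 G -> iint n F = iint n G.
Proof. by move=> /funext ->. Qed.

Lemma iintZl n (c : R) (F : (nat -> R) -> \bar R) : 0 <= c -> cmeas F ->
  (forall v, (0 <= F v)%E) -> (iint n (fun v => c%:E * F v) = c%:E * iint n F)%E.
Proof.
move=> c0; elim: n F => [|n IH] F mF F0 //.
rewrite !iintS -ge0_integralZl//.
- apply: eq_integral => t _; apply: (IH (fun v => F (slice n t v))) => //.
  exact: (coord_measurable_cmeas t (cmeas_slice n mF)).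
- by apply: (@measurable_iint n _ R) => //; exact: cmeas_slice.
- by move=> t _; exact: iint_ge0.
Qed.

Lemma iintD n (F G : (nat -> R) -> \bar R) : cmeas F -> cmeas G ->
  (forall v, (0 <= F v)%E) -> (forall v, (0 <= G v)%E) ->
  (iint n (fun v => F v + G v) = iint n F + iint n G)%E.
Proof.
elim: n F G => [|n IH] F G mF mG F0 G0 //.
rewrite !iintS -ge0_integralD//.
- apply: eq_integral => t _.
  apply: (IH (fun v => F (slice n t v)) (fun v => G (slice n t v))) => //.
  + exact: (coord_measurable_cmeas t (cmeas_slice n mF)).
  + exact: (coord_measurable_cmeas t (cmeas_slice n mG)).
- by move=> t _; exact: iint_ge0.
- by apply: (@measurable_iint n _ R) => //; exact: cmeas_slice.
- by move=> t _; exact: iint_ge0.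
- by apply: (@measurable_iint n _ R) => //; exact: cmeas_slice.
Qed.

Lemma iint0 n : iint n (fun _ : nat -> R => 0%E) = 0%E.
Proof. by elim: n => //= n IH; apply: integral0_eq => t _; exact: IH. Qed.

Lemma iint_sum n (I : finType) (F : I -> (nat -> R) -> \bar R) :
  (forall i, cmeas (F i)) -> (forall i v, (0 <= F i v)%E) ->
  (iint n (fun v => \sum_i F i v) = \sum_i iint n (F i))%E.
Proof.
move=> mF F0; elim: (index_enum I) => [|i s IH].
  by rewrite big_nil -[RHS](iint0 n); apply: eq_iint => v; rewrite big_nil.
rewrite big_cons -IH -iintD//.
- by apply: eq_iint => v; rewrite big_cons.
- move=> d S tau g mtau mg; apply: emeasurable_sum => j.
  exact: (mF j d S tau g).
- by move=> v; exact: sume_ge0.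
Qed.

Lemma iint_tonelli n (G : R -> (nat -> R) -> \bar R) : coord_measurable G ->
  (forall y v, (0 <= G y v)%E) ->
  (iint n (fun v => \int[mu]_y G y v) = \int[mu]_y iint n (G y))%E.
Proof.
elim: n G => [|n IH] G mG G0 //; rewrite iintS.
transitivity (\int[mu]_t \int[mu]_y iint n (fun v => G y (slice n t v)))%E.
  apply: eq_integral => t _; apply: (IH (fun y v => G y (slice n t v))) => //.
  have := coord_measurable_slice n mG.
  apply: (@coord_measurable_at _ (R * R)%type _ R (fun y => (y, t))).
  exact: measurable_fun_pair.
rewrite (@fubini_tonelli _ _ _ _ _ mu mu
  (fun p : R * R => iint n (fun v => G p.2 (slice n p.1 v))))//.
- apply: (@measurable_iint n _ (R * R)%type (fun p v => G p.2 (slice n p.1 v))) => //.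
  have := coord_measurable_slice n mG.
  apply: (@coord_measurable_at _ (R * R)%type _ (R * R)%type (fun p => (p.2, p.1))).
  exact: measurable_fun_pair.
- by move=> p; exact: iint_ge0.
Qed.
End iterated_integral.

(** * Positive parts of differences of two Gaussian densities in several dimensions *)

Section hinge_iint.
Context {R : realType}.
Local Notation mu := (@lebesgue_measure R).
Local Notation phi := (@normal_pdf R 0 1).

Lemma hinge0 (c1 c2 : R) : hinge 0 c1 c2 = (Num.max (c1 - c2) 0)%:E.
Proof.
rewrite -[RHS](integral_phi_lratio 0); apply: eq_integral => t _.
by rewrite lratio0 !mulr1.
Qed.

Lemma hinge_ge0 (d c1 c2 : R) : (0 <= hinge d c1 c2)%E.
Proof. by apply: integral_ge0 => t _; rewrite lee_fin hinge_fun_ge0. Qed.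

Lemma hingeZ (k d c1 c2 : R) : 0 <= k ->
  (k%:E * hinge d c1 c2 = hinge d (k * c1) (k * c2))%E.
Proof.
move=> k0; rewrite /hinge -ge0_integralZl//=.
- apply: eq_integral => t _; rewrite -EFinM mulrCA maxr_pMr// mulr0 mulrBr.
  by rewrite mulrA.
- by apply/measurable_EFinP; exact: measurable_hinge_fun.
- by move=> t _; rewrite lee_fin hinge_fun_ge0.
Qed.

Lemma measurable_hinge (d : R) (f1 f2 : R -> R) :
  measurable_fun setT f1 -> measurable_fun setT f2 ->
  measurable_fun setT (fun t => hinge d (f1 t) (f2 t)).
Proof.
move=> mf1 mf2.
pose f (z : R * R) := (phi z.2 * Num.max (f1 z.1 * lratio d z.2 - f2 z.1) 0)%:E.
apply: (@measurable_fun_fubini_tonelli_F _ _ _ _ _ mu f); last first.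
  by move=> z; rewrite lee_fin hinge_fun_ge0.
apply/measurable_EFinP; apply: measurable_funM.
  by apply: measurableT_comp => //; exact: measurable_phi.
apply: measurable_maxr => //; apply: measurable_funB; last exact: measurableT_comp.
apply: measurable_funM; first exact: measurableT_comp.
by apply: measurableT_comp => //; exact: measurable_lratio.
Qed.

(** Integrates out one more coordinate. Substituting t = sigma u + m2 standardises it, homogeneity
    moves the factors into the coefficients, and [hinge_rotation] merges the new distance with
    [d]. *)
Lemma integral_hinge_step (m1 m2 sigma d s c1 c2 : R) : 0 < sigma ->
  s ^+ 2 = d ^+ 2 + ((m1 - m2) / sigma) ^+ 2 ->
  (\int[mu]_t hinge d (c1 * normal_pdf m1 sigma t) (c2 * normal_pdf m2 sigma t)
   = hinge s c1 c2)%E.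
Proof.
move=> s0 sde.
rewrite (@ge0_integral_affine _ sigma m2) ?gt_eqF//; first last.
- by move=> t; exact: hinge_ge0.
- by apply: measurable_hinge; apply: measurable_funM => //;
    exact: measurable_normal_pdf.
rewrite -(hinge_rotation c1 c2 sde); apply: eq_integral => u _.
rewrite gtr0_norm// (hingeZ _ _ _ (ltW s0)) (hingeZ _ _ _ (phi_ge0 u)).
by rewrite !(mulrCA sigma) (density_at m1 m2 u s0) (density_at m2 m2 u s0)
  subrr mul0r lratio0 mulr1 (mulrCA (phi u)) (mulrC c2).
Qed.

Definition npdf n (m : nat -> R) (sigma : R) (v : nat -> R) : R :=
  \prod_(i < n) normal_pdf (m i) sigma (v i).

Lemma npdf_slice n m sigma t v :
  npdf n.+1 m sigma (slice n t v) = npdf n m sigma v * normal_pdf (m n) sigma t.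
Proof.
rewrite /npdf big_ord_recr/= /slice eqxx; congr (_ * _).
by apply: eq_bigr => i _; rewrite ltn_eqF.
Qed.

(** Each coordinate adds its squared standardised distance, by [integral_hinge_step]; with no
    coordinate left the distance is 0. *)
Lemma iint_hinge n (m1 m2 : nat -> R) (sigma s c1 c2 : R) : 0 < sigma ->
  s ^+ 2 = \sum_(i < n) ((m1 i - m2 i) / sigma) ^+ 2 ->
  iint n (fun v => (Num.max (c1 * npdf n m1 sigma v - c2 * npdf n m2 sigma v) 0)%:E)
  = hinge s c1 c2.
Proof.
move=> s0; elim: n s c1 c2 => [|n IH] s c1 c2.
  rewrite big_ord0 => /eqP; rewrite sqrf_eq0 => /eqP ->.
  by rewrite hinge0 /= /npdf !big_ord0 !mulr1.
rewrite big_ord_recr/= => sE.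
have d0 : 0 <= \sum_(i < n) ((m1 i - m2 i) / sigma) ^+ 2.
  by apply: sumr_ge0 => i _; exact: sqr_ge0.
rewrite -(sqr_sqrtr d0) in sE.
rewrite -(integral_hinge_step c1 c2 s0 sE); apply: eq_integral => t _.
rewrite -(IH (Num.sqrt _)) ?sqr_sqrtr//; apply: eq_iint => v.
rewrite -/(slice n t v) !npdf_slice.
by congr ((Num.max (_ - _) _)%:E); ring.
Qed.
End hinge_iint.

(** * Poisson subsampling and sensitivity *)

Lemma sum_binomial_pmf {R : realType} (K : nat) (r : R) : \sum_(i < K.+1) binomial_pmf K r i = 1.
Proof.
rewrite -[RHS](expr1n _ K) -[in RHS](subrK r 1) exprDn.
by apply: eq_bigr => i _; rewrite /binomial_pmf mulrC.
Qed.

Section combinatorics.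
Context {R : realType} {A : finType}.
Implicit Types (r : R) (C g y : {set A}).

Lemma poisson_sub_ge0 r x y : 0 <= r <= 1 -> 0 <= poisson_sub r x y.
Proof.
case/andP => r0 r1; rewrite /poisson_sub; case: ifP => // _.
by rewrite mulr_ge0// exprn_ge0// subr_ge0.
Qed.

(** The size of a Poisson subsample is binomial: subsets are grouped by cardinality and counted. *)
Lemma poisson_sum r g (phi : nat -> R) :
  \sum_(u : {set A}) poisson_sub r g u * phi #|u| =
  \sum_(i < #|g|.+1) binomial_pmf #|g| r i * phi i.
Proof.
transitivity (\sum_(u in powerset g) r ^+ #|u| * (1 - r) ^+ (#|g| - #|u|) * phi #|u|).
  rewrite [RHS]big_mkcond; apply: eq_bigr => u _.
  by rewrite powersetE /poisson_sub; case: ifP => // _; rewrite mul0r.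
(* Subsets of [g] have at most [#|g|] elements, so [inord] preserves their cardinality. *)
rewrite (partition_big (fun u : {set A} => inord #|u| : 'I_#|g|.+1) xpredT)//=.
apply: eq_bigr => i _.
transitivity (\sum_(u in [set B : {set A} | B \subset g & #|B| == i])
    r ^+ i * (1 - r) ^+ (#|g| - i) * phi i).
  apply: eq_big => u.
    rewrite inE powersetE; apply: andb_id2l => ug.
    by rewrite -val_eqE/= inordK// ltnS subset_leq_card.
  by rewrite powersetE => /andP[ug /eqP <-]; rewrite inordK// ltnS subset_leq_card.
rewrite sumr_const cards_draws /binomial_pmf.
by rewrite mulrnAl.
Qed.

Lemma sum_poisson_sub r g : \sum_(u : {set A}) poisson_sub r g u = 1.
Proof.
under eq_bigr do rewrite -[poisson_sub _ _ _]mulr1.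
rewrite (poisson_sum r g (fun=> 1)) -[RHS](sum_binomial_pmf #|g| r).
by apply: eq_bigr => i _; rewrite mulr1.
Qed.

(** Subsampling a disjoint union amounts to subsampling both parts independently, through the
    bijection sending y to its traces on [C] and [g]. *)
Lemma poisson_split r C g (F : {set A} -> R) : [disjoint C & g] ->
  \sum_(y : {set A}) F y * poisson_sub r (C :|: g) y =
  \sum_(p : {set A} * {set A})
    poisson_sub r C p.1 * poisson_sub r g p.2 * F (p.1 :|: p.2).
Proof.
move=> Cg.
transitivity (\sum_(y : {set A} | y \subset C :|: g) F y * poisson_sub r (C :|: g) y).
  rewrite [RHS]big_mkcond; apply: eq_bigr => y _.
  by rewrite /poisson_sub; case: ifP => // _; rewrite mulr0.
rewrite (reindex_onto (fun p : {set A} * {set A} => p.1 :|: p.2)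
  (fun y => (y :&: C, y :&: g))) /=; last first.
  by move=> y /finset.setIidPl yCg; rewrite -finset.setIUr.
rewrite [RHS](bigID (fun p : {set A} * {set A} => (p.1 \subset C) && (p.2 \subset g)))/=.
rewrite [X in _ = _ + X]big1 ?addr0; last first.
  move=> p; rewrite /poisson_sub negb_and => /orP[] /negbTE ->.
    by rewrite !mul0r.
  by rewrite mulr0 mul0r.
have CgI (B : {set A}) : (B \subset C) -> B :&: g = finset.set0.
  by move=> BC; apply: disjoint_setI0; exact: disjointWl Cg.
have gCI (B : {set A}) : (B \subset g) -> B :&: C = finset.set0.
  by move=> BC; apply: disjoint_setI0; rewrite disjoint_sym; exact: disjointWr Cg.
apply: eq_big => [[a b]|[a b]]/=.
  apply/idP/idP => [/andP[_ /eqP[<- <-]]|/andP[aC bg]].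
    by rewrite !finset.subsetIr.
  rewrite finset.setUSS//= !finset.setIUl (CgI a)// (gCI b)//.
  by rewrite finset.setU0 finset.set0U (finset.setIidPl aC) (finset.setIidPl bg).
move=> /andP[sub /eqP[aE bE]].
have aC : a \subset C by rewrite -aE finset.subsetIr.
have bg : b \subset g by rewrite -bE finset.subsetIr.
rewrite /poisson_sub sub aC bg mulrC; congr (_ * _).
have ab : [disjoint a & b] by apply: disjointWl aC _; exact: disjointWr bg Cg.
rewrite !cardsU (disjoint_setI0 Cg) (disjoint_setI0 ab) !cards0 !subn0.
have /subset_leq_card aCn := aC.
have /subset_leq_card bgn := bg.
rewrite exprD (_ : _ - _ = (#|C| - #|a|) + (#|g| - #|b|))%N; last by lia.
by rewrite exprD; ring.
Qed.
End combinatorics.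

Section sensitivity.
Context {R : realType} {A : finType} (D : nat) (h : {set A} -> 'rV[R]_D).

Definition sqdist (y y' : {set A}) : R := \sum_(i < D) (h y ord0 i - h y' ord0 i) ^+ 2.

Lemma L2sens_ge0 : 0 <= L2sens h.
Proof.
rewrite /L2sens; elim/big_ind: _ => // [a b a0 b0|y _]; first by rewrite le_max a0.
elim/big_ind: _ => // [a b a0 b0|y' _]; first by rewrite le_max a0.
exact: sqrtr_ge0.
Qed.

Lemma sqdist_adj y a : sqdist (a |: y) y <= L2sens h ^+ 2.
Proof.
have [ay|ay] := boolP (a \in y).
  rewrite (finset.setUidPr _) ?finset.sub1set// /sqdist big1 ?sqr_ge0// => i _.
  by rewrite subrr expr0n.
have s0 : 0 <= sqdist (a |: y) y by apply: sumr_ge0 => i _; exact: sqr_ge0.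
suff H : norm2 (h (a |: y) - h y) <= L2sens h.
  rewrite -(sqr_sqrtr s0) lerXn2r ?nnegrE ?sqrtr_ge0 ?L2sens_ge0//.
  apply: le_trans H; rewrite /norm2 /sqdist.
  by under [in leRHS]eq_bigr do rewrite !mxE.
have adj : batch_adj (a |: y) y by exists a; right.
rewrite /L2sens.
apply: le_trans (le_bigmax _ _ (a |: y)).
by apply: le_bigmax_cond; apply/asboolP.
Qed.

(* Instead of the triangle inequality, the one-element steps are chained by
   [(X + Y)^2 <= (1 + 1/n) X^2 + (1 + n) Y^2]. *)
Lemma sqdist_union (y u : {set A}) :
  sqdist (y :|: u) y <= (#|u|%:R * L2sens h) ^+ 2.
Proof.
move Hn : #|u| => n; elim: n u Hn => [|n IH] u Hn.
  rewrite (cards0_eq Hn) finset.setU0 /sqdist big1 ?sqr_ge0// => i _.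
  by rewrite subrr expr0n.
have /card_gt0P[a au] : (0 < #|u|)%N by rewrite Hn.
have Hn' : #|u :\ a| = n by move: Hn; rewrite (cardsD1 a) au => -[].
have := IH _ Hn'; set y' := y :|: (u :\ a) => y'y.
have -> : y :|: u = a |: y' by rewrite /y' finset.setUCA finset.setD1K.
have ay' := sqdist_adj y' a.
have [n0|n0] := posnP n.
  have -> : y = y' by rewrite /y' (cards0_eq (etrans Hn' n0)) finset.setU0.
  by rewrite n0 mul1r.
have n0' : 0 < n%:R :> R by rewrite ltr0n.
have step : sqdist (a |: y') y <=
    (1 + n%:R^-1) * sqdist y' y + (1 + n%:R) * sqdist (a |: y') y'.
  rewrite /sqdist !mulr_sumr -big_split/=; apply: ler_sum => i _.
  set p := h (a |: y') _ _; set q := h y' _ _; set s := h y _ _.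
  rewrite -subr_ge0; set X := q - s; set Y := p - q.
  have -> : p - s = X + Y by rewrite /X /Y; ring.
  have -> : (1 + n%:R^-1) * X ^+ 2 + (1 + n%:R) * Y ^+ 2 - (X + Y) ^+ 2 =
      n%:R * (n%:R^-1 * X - Y) ^+ 2.
    by field; rewrite gt_eqF.
  by rewrite mulr_ge0 ?sqr_ge0// ltW.
apply: (le_trans step).
apply: (@le_trans _ _ ((1 + n%:R^-1) * (n%:R * L2sens h) ^+ 2 +
                       (1 + n%:R) * L2sens h ^+ 2)).
  by apply: lerD; rewrite ler_wpM2l// addr_ge0// ?invr_ge0 ltW.
(* Since (1 + 1/n) n^2 + (1 + n) = (n + 1)^2, the weights give exactly the constant of the triangle
   inequality. *)
rewrite le_eqVlt; apply/orP; left; apply/eqP.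
by rewrite -[n.+1]addn1 natrD; field; rewrite gt_eqF.
Qed.
End sensitivity.

(** * Comonotonicity of the univariate mixtures *)

Section comonotone.
Context {R : realType}.
Variables (c r alpha : R) (Km Kp : nat).
Hypotheses (c0 : 0 <= c) (r01 : 0 <= r <= 1) (alpha0 : 0 <= alpha).
Local Notation mu := (@lebesgue_measure R).
Local Notation phi := (@normal_pdf R 0 1).

(* The difference of the one-dimensional mixtures relative to the Gaussian
   density they share at [i = j = 0], in units of the standard deviation. *)
Definition excess (t : R) : R :=
  \sum_(i < Km.+1) binomial_pmf Km r i * lratio (i%:R * c) t
  - alpha * \sum_(j < Kp.+1) binomial_pmf Kp r j * lratio (- j%:R * c) t.

Lemma lratio_nondecreasing (d s t : R) : 0 <= d -> s <= t -> lratio d s <= lratio d t.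
Proof. by move=> d0 st; rewrite ler_expR lerD2r ler_wpM2l. Qed.

Lemma lratio_nonincreasing (d s t : R) : d <= 0 -> s <= t -> lratio d t <= lratio d s.
Proof. by move=> d0 st; rewrite ler_expR lerD2r ler_wnM2l. Qed.

Let pos_slope (i : nat) : 0 <= i%:R * c. Proof. exact: mulr_ge0. Qed.
Let neg_slope (i : nat) : - i%:R * c <= 0. Proof. by rewrite mulNr oppr_le0. Qed.

Lemma excess_nondecreasing (s t : R) : s <= t -> excess s <= excess t.
Proof.
move=> st; rewrite /excess lerD// ?lerN2 ?ler_wpM2l//; apply: ler_sum => i _;
  rewrite ler_wpM2l ?binomial_pmf_ge0//.
- exact: lratio_nondecreasing.
- exact: lratio_nonincreasing.
Qed.

(* Every term crosses zero at the same [t0], hence positive parts add up. *)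
Lemma excess_comonotone (t0 t : R) :
  \sum_(i < Km.+1) binomial_pmf Km r i *
     Num.max (1 * lratio (i%:R * c) t - lratio (i%:R * c) t0) 0
  + \sum_(j < Kp.+1) (alpha * binomial_pmf Kp r j) *
     Num.max (-1 * lratio (- j%:R * c) t - - lratio (- j%:R * c) t0) 0
  = Num.max (excess t - excess t0) 0.
Proof.
have [tt0|tt0] := leP t0 t.
  rewrite (max_idPl _) ?subr_ge0 ?excess_nondecreasing//.
  rewrite (eq_bigr (fun i : 'I_Km.+1 => binomial_pmf Km r i * lratio (i%:R * c) t
      - binomial_pmf Km r i * lratio (i%:R * c) t0)); last first.
    move=> i _; rewrite (max_idPl _) ?mul1r ?mulrBr//.
    by rewrite subr_ge0 lratio_nondecreasing.
  rewrite (eq_bigr (fun j : 'I_Kp.+1 => alpha * (binomial_pmf Kp r j * lratio (- j%:R * c) t0)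
      - alpha * (binomial_pmf Kp r j * lratio (- j%:R * c) t))); last first.
    move=> j _; rewrite (max_idPl _); first by ring.
    by rewrite mulN1r opprK addrC subr_ge0 lratio_nonincreasing.
  by rewrite !sumrB -!mulr_sumr /excess; ring.
have tt0' := ltW tt0.
rewrite (max_idPr _) ?subr_le0 ?excess_nondecreasing//.
rewrite big1 ?add0r; last first.
  move=> i _; rewrite (max_idPr _) ?mulr0// mul1r subr_le0.
  exact: lratio_nondecreasing.
rewrite big1// => i _; rewrite (max_idPr _) ?mulr0//.
by rewrite mulN1r opprK addrC subr_le0 lratio_nonincreasing.
Qed.

Lemma continuous_lratio (d : R) : continuous (lratio d).
Proof.
move=> t; apply: (cvg_comp (fun t => d * t - d ^+ 2 / 2) expR).
  apply: cvgB; last exact: cvg_cst.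
  by apply: cvgM; [exact: cvg_cst|exact: cvg_id].
exact: continuous_expR.
Qed.

Lemma continuous_excess : continuous excess.
Proof.
have sum_cont n (w : 'I_n -> R) (d : 'I_n -> R) :
    continuous (fun t => \sum_(i < n) w i * lratio (d i) t).
  elim: n w d => [|n IH] w d.
    have -> : (fun t => \sum_(i < 0) w i * lratio (d i) t) = fun=> 0.
      by apply/funext => t; rewrite big_ord0.
    exact: cst_continuous.
  have -> : (fun t => \sum_(i < n.+1) w i * lratio (d i) t) = (fun t =>
      w ord0 * lratio (d ord0) t + \sum_(i < n) w (lift ord0 i) * lratio (d (lift ord0 i)) t).
    by apply/funext => t; rewrite big_ord_recl.
  move=> t; apply: cvgD; last exact: (IH (fun i => w (lift ord0 i)) (fun i => d (lift ord0 i))).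
  by apply: cvgM; [exact: cvg_cst|exact: continuous_lratio].
move=> t; apply: cvgB; first exact: sum_cont.
by apply: cvgM; [exact: cvg_cst|exact: sum_cont].
Qed.

Lemma measurable_excess : measurable_fun setT excess.
Proof. exact: continuous_measurable_fun continuous_excess. Qed.

Lemma integrable_phi_excess :
  mu.-integrable setT (fun t => (phi t * excess t)%:E).
Proof.
have -> : (fun t => (phi t * excess t)%:E) = (fun t =>
    \sum_(i < Km.+1) (phi t * (binomial_pmf Km r i * lratio (i%:R * c) t))%:E -
    \sum_(j < Kp.+1) (phi t * (alpha * binomial_pmf Kp r j * lratio (- j%:R * c) t))%:E)%E.
  apply/funext => t; rewrite !sumEFin -EFinB -!mulr_sumr -mulrBr; congr (phi t * (_ - _))%:E.
  by rewrite mulr_sumr; apply: eq_bigr => j _; rewrite mulrA.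
by apply: integrableB => //; apply: integrable_sum => // i _;
  exact: integrable_phi_lratio.
Qed.

(** By the intermediate value theorem, a continuous function without zeros cannot take both signs;
    monotonicity orders the two points. *)
Lemma excess_constant_sign :
  [\/ exists t0, excess t0 = 0, forall t, 0 < excess t | forall t, excess t < 0].
Proof.
have [[t0 t00]|nz] := pselect (exists t0, excess t0 = 0).
  by apply: Or31; exists t0.
have nz' t : excess t != 0 by apply/eqP => e; apply: nz; exists t.
have [[a a0]|npos] := pselect (exists a, 0 < excess a); last first.
  apply: Or33 => t; rewrite lt_neqAle nz'/= leNgt; apply/negP => t0.
  by apply: npos; exists t.
apply: Or32 => t; rewrite ltNge; apply/negP => t0.
have ta : t <= a.
  rewrite leNgt; apply/negP => /ltW/excess_nondecreasing.
  by move=> /(le_trans)/(_ t0); rewrite leNgt a0.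
have cf : {within `[t, a], continuous excess}%classic.
  exact/continuous_subspaceT/continuous_excess.
have v0 : Num.min (excess t) (excess a) <= 0 <= Num.max (excess t) (excess a).
  by rewrite ge_min t0 le_max (ltW a0) orbT.
have [x _ x0] := IVT ta cf v0.
by apply: nz; exists x.
Qed.

(** By subadditivity this bounds the positive part of [excess t] from above, with equality when
    [excess t0 = 0]. Its first summand is the one that [excess_comonotone] splits into
    components. *)
Definition clipped (t0 t : R) : R :=
  Num.max (excess t - excess t0) 0 + Num.max (excess t0) 0.

Lemma clipped_ge0 t0 t : 0 <= clipped t0 t.
Proof. by rewrite addr_ge0// le_max lexx orbT. Qed.

Lemma measurable_phi_clipped t0 :
  measurable_fun setT (fun t => (phi t * clipped t0 t)%:E).
Proof.
apply/measurable_EFinP; apply: measurable_funM; first exact: measurable_phi.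
apply: measurable_funD => //; apply: measurable_maxr => //.
by apply: measurable_funB => //; exact: measurable_excess.
Qed.

(** Dominated convergence along a sequence of reference points; the dominating function is
    integrable against [phi]. *)
Lemma clipped_dominated (X : \bar R) (t_ : nat -> R) :
  (forall t, (\forall n \near \oo, clipped (t_ n) t = Num.max (excess t) 0)%classic) ->
  (forall n t, clipped (t_ n) t <= `|excess t| + `|excess 0|) ->
  (forall n, (X <= \int[mu]_t (phi t * clipped (t_ n) t)%:E)%E) ->
  (X <= \int[mu]_t (phi t * Num.max (excess t) 0)%:E)%E.
Proof.
move=> lim dom Xle.
have [|||||] := @dominated_convergence _ _ _ mu setT measurableT
  (fun n t => (phi t * clipped (t_ n) t)%:E)
  (fun t => (phi t * Num.max (excess t) 0)%:E)
  (fun t => `|(phi t * excess t)%:E| + (phi t * (`|excess 0| * lratio 0 t))%:E)%E.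
- by move=> n; exact: measurable_phi_clipped.
- apply/measurable_EFinP; apply: measurable_funM; first exact: measurable_phi.
  by apply: measurable_maxr => //; exact: measurable_excess.
- apply: aeW => t _; apply: cvg_near_cst.
  by apply: filterS (lim t) => n ->.
- apply: integrableD => //; last exact: integrable_phi_lratio.
  exact: integrable_abse integrable_phi_excess.
- apply: aeW => t n _; rewrite abse_EFin ger0_norm ?mulr_ge0 ?phi_ge0 ?clipped_ge0//.
  rewrite abse_EFin -EFinD lee_fin normrM (ger0_norm (phi_ge0 t)) -mulrDr.
  by rewrite lratio0 mulr1 ler_wpM2l ?phi_ge0.
- move=> _ _ /cvge_to_ge; apply.
  by apply: nearW => n; exact: Xle.
Qed.

Lemma le_excess_integral (X : \bar R) :
  (forall t0, (X <= \int[mu]_t (phi t * clipped t0 t)%:E)%E) ->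
  (X <= \int[mu]_t (phi t * Num.max (excess t) 0)%:E)%E.
Proof.
move=> Xle; case: excess_constant_sign => [[t0 t00]|pos|neg].
- apply: (le_trans (Xle t0)); rewrite le_eqVlt; apply/orP; left; apply/eqP.
  by apply: eq_integral => t _; rewrite /clipped t00 subr0 maxxx addr0.
(* If [excess] is positive, [clipped t0 t] equals [excess t] once [t0 <= t], so [t0] runs to -oo.
   For t below -n the value is [excess (- n%:R)], at most [excess 0]. *)
- apply: (@clipped_dominated X (fun n => - n%:R)) => //.
  + move=> t; near=> n.
    have nt : - n%:R <= t.
      rewrite lerNl; near: n; exact: nbhs_infty_ger.
    rewrite /clipped !(max_idPl _) ?(ltW (pos _))//; first by rewrite subrK.
    by rewrite subr_ge0 excess_nondecreasing.
  + move=> n t; rewrite /clipped (max_idPl (ltW (pos (- n%:R)))).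
    rewrite !gtr0_norm ?pos// -lerBrDr ge_max.
    have e0 : excess (- n%:R) <= excess 0 by rewrite excess_nondecreasing ?oppr_le0.
    have := pos t; have := pos 0; have := pos (- n%:R).
    by move=> p1 p2 p3; apply/andP; split; lra.
(* If [excess] is negative, [clipped t0 t] vanishes once [t <= t0], so [t0] runs to +oo. *)
- apply: (@clipped_dominated X (fun n => n%:R)) => //.
  + move=> t; near=> n.
    have nt : t <= n%:R by near: n; exact: nbhs_infty_ger.
    rewrite /clipped !(max_idPr _) ?(ltW (neg _))//; first by rewrite addr0.
    by rewrite subr_le0 excess_nondecreasing.
  + move=> n t; rewrite /clipped [X in _ + X](max_idPr (ltW (neg n%:R))).
    rewrite !ltr0_norm ?neg// addr0 ge_max.
    have e0 : excess 0 <= excess n%:R by rewrite excess_nondecreasing.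
    have := neg t; have := neg 0; have := neg n%:R.
    by move=> p1 p2 p3; apply/andP; split; lra.
Unshelve. all: by end_near. Qed.

End comonotone.

(** * Hockey-stick divergence *)

Section hockey.
Context {R : realType} {A : finType} (D : nat).
Variables (h : {set A} -> 'rV[R]_D) (sigma r : R).
Hypotheses (sigma0 : 0 < sigma) (r01 : 0 <= r <= 1) (L0 : 0 < L2sens h).
Local Notation mu := (@lebesgue_measure R).
Local Notation phi := (@normal_pdf R 0 1).
Local Notation c := (L2sens h / sigma).

(** Extended by 0 to all of [nat] to fit [npdf], which at dimension [D] reads the indices below
    [D]. *)
Definition mean (y : {set A}) (k : nat) : R := oapp (h y ord0) 0 (insub k).

Definition dens (y : {set A}) (v : nat -> R) : R := npdf D (mean y) sigma v.

Lemma densE y (v : nat -> R) :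
  gauss_density h sigma y (\row_(i < D) v i) = dens y v.
Proof.
rewrite /gauss_density /dens /npdf; apply: eq_bigr => i _.
by rewrite mxE /mean valK.
Qed.

Lemma dens_gt0 y v : 0 < dens y v.
Proof.
apply: prodr_gt0 => i _; rewrite normal_pdfE ?gt_eqF// mulr_gt0 ?expR_gt0//.
by rewrite normal_peak_gt0 ?gt_eqF.
Qed.

Lemma dens_ge0 y v : 0 <= dens y v. Proof. exact/ltW/dens_gt0. Qed.

Lemma measurable_dens y d' (S : measurableType d') (g : nat -> S -> R) :
  (forall k, measurable_fun setT (g k)) ->
  measurable_fun setT (fun s => dens y (fun k => g k s)).
Proof.
move=> mg; rewrite /dens /npdf; elim: D => [|n IH].
  by have -> : (fun s : S => \prod_(i < 0) normal_pdf (mean y i) sigma (g i s)) = fun=> 1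
    by apply/funext => s; rewrite big_ord0.
have -> : (fun s : S => \prod_(i < n.+1) normal_pdf (mean y i) sigma (g i s)) =
    (fun s => (\prod_(i < n) normal_pdf (mean y i) sigma (g i s))
              * normal_pdf (mean y n) sigma (g n s))
  by apply/funext => s; rewrite big_ord_recr.
apply: measurable_funM => //; apply: measurableT_comp => //.
exact: measurable_normal_pdf.
Qed.

Definition densdiff (y1 y2 : {set A}) (c1 c2 : R) (v : nat -> R) : R :=
  Num.max (c1 * dens y1 v - c2 * dens y2 v) 0.

Lemma densdiff_ge0 y1 y2 c1 c2 v : 0 <= densdiff y1 y2 c1 c2 v.
Proof. by rewrite le_max lexx orbT. Qed.

Lemma cmeas_densdiff y1 y2 c1 c2 : cmeas (fun v => (densdiff y1 y2 c1 c2 v)%:E).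
Proof.
move=> d' S tau g _ mg; apply/measurable_EFinP; apply: measurable_maxr => //.
by apply: measurable_funB; apply: measurable_funM => //; exact: measurable_dens.
Qed.

(** The left side is a hinge at the true standardised distance, which [hinge_le] enlarges. Only the
    square of [k] matters, so the negative shifts of the second mixture are covered. *)
Lemma iint_densdiff_le y1 y2 c1 c2 (k : R) :
  sqdist h y1 y2 <= (k * L2sens h) ^+ 2 ->
  (iint D (fun v => (densdiff y1 y2 c1 c2 v)%:E) <= hinge (k * c) c1 c2)%E.
Proof.
move=> dk; set q := \sum_(i < D) ((mean y1 i - mean y2 i) / sigma) ^+ 2.
have q0 : 0 <= q by apply: sumr_ge0 => i _; exact: sqr_ge0.
rewrite (iint_hinge c1 c2 sigma0 (sqr_sqrtr q0)); apply: hinge_le.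
rewrite sqr_sqrtr// mulrA expr_div_n ler_pdivlMr ?exprn_gt0//.
apply: le_trans dk; rewrite /q /sqdist mulr_suml le_eqVlt; apply/orP; left.
apply/eqP/eq_bigr => i _; rewrite /mean !valK /= expr_div_n divfK//.
by rewrite gt_eqF// exprn_gt0.
Qed.

Lemma iint_wsum n (I : finType) (k : I -> R) (H : I -> (nat -> R) -> R) :
  (forall i, 0 <= k i) -> (forall i v, 0 <= H i v) ->
  (forall i, cmeas (fun v => (H i v)%:E)) ->
  (iint n (fun v => (\sum_i k i * H i v)%:E) =
   \sum_i (k i)%:E * iint n (fun v => (H i v)%:E))%E.
Proof.
move=> k0 H0 mH.
transitivity (iint n (fun v => \sum_i ((k i)%:E * (H i v)%:E)))%E.
  by apply: eq_iint => v; rewrite -sumEFin.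
rewrite iint_sum.
- by apply: eq_bigr => i _; rewrite iintZl// => v; rewrite lee_fin.
- move=> i d' S tau g mtau mg; apply: emeasurable_funM => //.
  exact: (mH i d' S tau g).
- by move=> i v; rewrite mule_ge0// lee_fin.
Qed.

Lemma cmeas_wsum (I : finType) (k : I -> R) (H : I -> (nat -> R) -> R) :
  (forall i, cmeas (fun v => (H i v)%:E)) ->
  cmeas (fun v => (\sum_i k i * H i v)%:E).
Proof.
move=> mH d' S tau g mtau mg; apply/measurable_EFinP.
apply: measurable_sum => i; apply: measurable_funM => //.
by apply/measurable_EFinP; exact: (mH i d' S tau g).
Qed.

Definition mix (x : {set A}) (v : nat -> R) : R :=
  \sum_(y : {set A}) dens y v * poisson_sub r x y.

Lemma mixE x (v : nat -> R) :
  mix_density h sigma r x (\row_(i < D) v i) = mix x v.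
Proof. by apply: eq_bigr => y _; rewrite densE. Qed.

Lemma mix_ge0 x v : 0 <= mix x v.
Proof.
by apply: sumr_ge0 => y _; rewrite mulr_ge0 ?dens_ge0// poisson_sub_ge0.
Qed.

(** Covers [r = 0] and [r = 1] as well: the densities are positive and the weights sum to 1, so some
    weight is nonzero. *)
Lemma mix_gt0 x v : 0 < mix x v.
Proof.
rewrite lt_neqAle mix_ge0 andbT eq_sym; apply/negP => /eqP m0.
suff : \sum_(y : {set A}) poisson_sub r x y = 0.
  by rewrite sum_poisson_sub => /eqP; rewrite oner_eq0.
apply: big1 => y _; have : dens y v * poisson_sub r x y = 0.
  apply: (psumr_eq0P _ m0) => // y' _.
  by rewrite mulr_ge0 ?dens_ge0// poisson_sub_ge0.
by move=> /eqP; rewrite mulf_eq0 gt_eqF ?dens_gt0//= => /eqP.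
Qed.

Lemma measurable_mix x d' (S : measurableType d') (g : nat -> S -> R) :
  (forall k, measurable_fun setT (g k)) ->
  measurable_fun setT (fun s => mix x (fun k => g k s)).
Proof.
move=> mg; apply: measurable_sum => y; apply: measurable_funM => //.
exact: measurable_dens.
Qed.

(** The component bounds depend on the second subsample through its size only; the first subsample
    sums out to 1. *)
Lemma poisson_pair_sum C g (b : nat -> R) :
  \sum_(p : {set A} * {set A}) poisson_sub r C p.1 * poisson_sub r g p.2 * b #|p.2|
  = \sum_(i < #|g|.+1) binomial_pmf #|g| r i * b i.
Proof.
rewrite -(pair_bigA _ (fun C' u => poisson_sub r C C' * poisson_sub r g u * b #|u|))/=.
under eq_bigr do under eq_bigr do rewrite -mulrA.
under eq_bigr do rewrite -mulr_sumr.
by rewrite -mulr_suml sum_poisson_sub mul1r poisson_sum.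
Qed.

Variables (alpha : R) (C gm gp : {set A}).
Hypotheses (alpha0 : 0 <= alpha) (Cgm : [disjoint C & gm]) (Cgp : [disjoint C & gp]).
Local Notation f := (excess c r alpha #|gm| #|gp|).

(** Values of the univariate components at [t0], reused as the subtracted constants in dimension
    [D]. *)
Let a t0 (i : nat) := lratio (i%:R * c) t0.
Let b t0 (j : nat) := lratio (- j%:R * c) t0.

(** Mirrors [excess_comonotone] with [dens C'] as the shared density. Subtracting the constants [a]
    and [b] from the components leaves [excess] at [t0] times the mixture of the [dens C']. Here
    positive parts are only subadditive, whence an inequality. *)
Lemma mix_diff_le t0 v :
  Num.max (mix (C :|: gm) v - alpha * mix (C :|: gp) v) 0 <=
  \sum_(p : {set A} * {set A}) poisson_sub r C p.1 * poisson_sub r gm p.2 *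
     densdiff (p.1 :|: p.2) p.1 1 (a t0 #|p.2|) v
  + \sum_(p : {set A} * {set A}) alpha * (poisson_sub r C p.1 * poisson_sub r gp p.2) *
     densdiff (p.1 :|: p.2) p.1 (-1) (- b t0 #|p.2|) v
  + \sum_(C' : {set A}) poisson_sub r C C' * densdiff C' C' (Num.max (f t0) 0) 0 v.
Proof.
have P0 (B y : {set A}) : 0 <= poisson_sub r B y := poisson_sub_ge0 B y r01.
rewrite ge_max; apply/andP; split; last first.
  by rewrite !addr_ge0// sumr_ge0// => p _; rewrite ?mulr_ge0// ?densdiff_ge0// ?mulr_ge0.
apply: (@le_trans _ _ (
  \sum_(p : {set A} * {set A}) poisson_sub r C p.1 * poisson_sub r gm p.2 *
     (1 * dens (p.1 :|: p.2) v - a t0 #|p.2| * dens p.1 v)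
  + \sum_(p : {set A} * {set A}) alpha * (poisson_sub r C p.1 * poisson_sub r gp p.2) *
     (-1 * dens (p.1 :|: p.2) v - (- b t0 #|p.2|) * dens p.1 v)
  + \sum_(C' : {set A}) poisson_sub r C C' * (f t0 * dens C' v))); last first.
  rewrite !lerD//; apply: ler_sum => p _; rewrite ler_wpM2l ?mulr_ge0// /densdiff.
  - by rewrite le_max lexx.
  - by rewrite le_max lexx.
  - rewrite mul0r subr0 le_max; apply/orP; left.
    by rewrite ler_wpM2r ?dens_ge0// le_max lexx.
rewrite le_eqVlt; apply/orP; left; apply/eqP.
(* The compensating terms factor, because the constants see a subset only through its size. *)
have cross (g : {set A}) (w : nat -> R) :
    \sum_(p : {set A} * {set A}) poisson_sub r C p.1 * poisson_sub r g p.2 *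
      (w #|p.2| * dens p.1 v) =
    (\sum_(C' : {set A}) poisson_sub r C C' * dens C' v) *
    \sum_(i < #|g|.+1) binomial_pmf #|g| r i * w i.
  rewrite -poisson_sum mulr_suml.
  rewrite -(pair_bigA _ (fun C' u => poisson_sub r C C' * poisson_sub r g u *
    (w #|u| * dens C' v)))/=; apply: eq_bigr => C' _.
  by rewrite mulr_sumr; apply: eq_bigr => u _; ring.
rewrite /mix (poisson_split r (fun y => dens y v) Cgm).
rewrite (poisson_split r (fun y => dens y v) Cgp).
rewrite [X in _ = X + _ + _](eq_bigr (fun p : {set A} * {set A} =>
  poisson_sub r C p.1 * poisson_sub r gm p.2 * dens (p.1 :|: p.2) v -
  poisson_sub r C p.1 * poisson_sub r gm p.2 * (a t0 #|p.2| * dens p.1 v)));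
  last by move=> p _; ring.
rewrite [X in _ = _ + X + _](eq_bigr (fun p : {set A} * {set A} =>
  alpha * (poisson_sub r C p.1 * poisson_sub r gp p.2 * (b t0 #|p.2| * dens p.1 v)) -
  alpha * (poisson_sub r C p.1 * poisson_sub r gp p.2 * dens (p.1 :|: p.2) v)));
  last by move=> p _; ring.
rewrite !sumrB -!mulr_sumr !cross.
have -> : \sum_(C' : {set A}) poisson_sub r C C' * (f t0 * dens C' v) =
    f t0 * \sum_(C' : {set A}) poisson_sub r C C' * dens C' v.
  by rewrite mulr_sumr; apply: eq_bigr => C' _; ring.
rewrite /excess -/(a t0) -/(b t0).
by rewrite /a /b; ring.
Qed.

(** Both sides meet in one sum of hinges: it bounds the left side by [mix_diff_le] and the
    sensitivity, and equals the right side by [excess_comonotone]. *)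
Lemma iint_mix_diff_le t0 :
  (iint D (fun v => (Num.max (mix (C :|: gm) v - alpha * mix (C :|: gp) v) 0)%:E)
   <= \int[mu]_t (phi t * clipped c r alpha #|gm| #|gp| t0 t)%:E)%E.
Proof.
have P0 (B y : {set A}) : 0 <= poisson_sub r B y := poisson_sub_ge0 B y r01.
have Bin0 n i : 0 <= binomial_pmf n r i by exact: binomial_pmf_ge0.
pose B1 i := hinge (i%:R * c) 1 (a t0 i).
pose B2 j := hinge (- j%:R * c) (-1) (- b t0 j).
apply: (@le_trans _ _ (
  \sum_(i < #|gm|.+1) (binomial_pmf #|gm| r i)%:E * B1 i +
  \sum_(j < #|gp|.+1) (alpha * binomial_pmf #|gp| r j)%:E * B2 j +
  (Num.max (f t0) 0)%:E)%E).
  pose H1 (p : {set A} * {set A}) := densdiff (p.1 :|: p.2) p.1 1 (a t0 #|p.2|).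
  pose H2 (p : {set A} * {set A}) := densdiff (p.1 :|: p.2) p.1 (-1) (- b t0 #|p.2|).
  pose H3 C' := densdiff C' C' (Num.max (f t0) 0) 0.
  pose k1 (p : {set A} * {set A}) := poisson_sub r C p.1 * poisson_sub r gm p.2.
  pose k2 (p : {set A} * {set A}) := alpha * (poisson_sub r C p.1 * poisson_sub r gp p.2).
  have k10 p : 0 <= k1 p by rewrite mulr_ge0.
  have k20 p : 0 <= k2 p by rewrite !mulr_ge0.
  have mH1 p : cmeas (fun v => (H1 p v)%:E) by exact: cmeas_densdiff.
  have mH2 p : cmeas (fun v => (H2 p v)%:E) by exact: cmeas_densdiff.
  have mH3 p : cmeas (fun v => (H3 p v)%:E) by exact: cmeas_densdiff.
  have H10 p v : 0 <= H1 p v by exact: densdiff_ge0.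
  have H20 p v : 0 <= H2 p v by exact: densdiff_ge0.
  have H30 p v : 0 <= H3 p v by exact: densdiff_ge0.
  have s10 v : (0 <= (\sum_p k1 p * H1 p v)%:E)%E.
    by rewrite lee_fin sumr_ge0// => p _; rewrite mulr_ge0.
  have s20 v : (0 <= (\sum_p k2 p * H2 p v)%:E)%E.
    by rewrite lee_fin sumr_ge0// => p _; rewrite mulr_ge0.
  have s30 v : (0 <= (\sum_p poisson_sub r C p * H3 p v)%:E)%E.
    by rewrite lee_fin sumr_ge0// => p _; rewrite mulr_ge0.
  have m1 := cmeas_wsum k1 mH1.
  have m2 := cmeas_wsum k2 mH2.
  have m3 := cmeas_wsum (poisson_sub r C) mH3.
  have m12 : cmeas (fun v => (\sum_p k1 p * H1 p v)%:E + (\sum_p k2 p * H2 p v)%:E)%E.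
    by move=> d' S tau g mtau mg; apply: emeasurable_funD;
      [exact: (m1 d' S tau g)|exact: (m2 d' S tau g)].
  apply: (@le_trans _ _ (iint D (fun v => (\sum_p k1 p * H1 p v)%:E
    + (\sum_p k2 p * H2 p v)%:E + (\sum_p poisson_sub r C p * H3 p v)%:E)%E)).
    apply: le_iint.
    - move=> d' S tau g _ mg; apply/measurable_EFinP; apply: measurable_maxr => //.
      by apply: measurable_funB; [|apply: measurable_funM => //]; exact: measurable_mix.
    - by move=> d' S tau g mtau mg; apply: emeasurable_funD;
        [exact: (m12 d' S tau g)|exact: (m3 d' S tau g)].
    - by move=> v; rewrite lee_fin le_max lexx orbT.
    - by move=> v; rewrite -!EFinD lee_fin; exact: mix_diff_le.
  rewrite iintD//; last by move=> v; exact: adde_ge0.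
  rewrite iintD// !iint_wsum//.
  apply: leeD; first apply: leeD.
  - apply: (@le_trans _ _ (\sum_p (k1 p)%:E * B1 #|p.2|)%E).
      apply: lee_sum => p _; rewrite lee_wpmul2l ?lee_fin//.
      exact: iint_densdiff_le (sqdist_union h p.1 p.2).
    rewrite le_eqVlt; apply/orP; left; apply/eqP.
    (* [poisson_pair_sum] is an identity between reals, hence the passage through [fine]; hinges are
       finite. *)
    rewrite (eq_bigr (fun p => (k1 p * fine (B1 #|p.2|))%:E)); last first.
      by move=> p _; rewrite -[B1 _]fineK ?hinge_fin_num// -EFinM.
    rewrite sumEFin (poisson_pair_sum C gm (fun i => fine (B1 i))) -sumEFin.
    by apply: eq_bigr => i _; rewrite -[B1 _]fineK ?hinge_fin_num// -EFinM.
  - apply: (@le_trans _ _ (\sum_p (k2 p)%:E * B2 #|p.2|)%E).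
      apply: lee_sum => p _; rewrite lee_wpmul2l ?lee_fin//.
      apply: iint_densdiff_le; rewrite mulNr sqrrN.
      exact: sqdist_union.
    rewrite le_eqVlt; apply/orP; left; apply/eqP.
    rewrite (eq_bigr (fun p => (poisson_sub r C p.1 * poisson_sub r gp p.2 *
        (alpha * fine (B2 #|p.2|)))%:E)); last first.
      move=> p _; rewrite -[B2 _]fineK ?hinge_fin_num// -EFinM; congr (_%:E).
      by rewrite /k2; ring.
    rewrite sumEFin (poisson_pair_sum C gp (fun i => alpha * fine (B2 i))) -sumEFin.
    apply: eq_bigr => i _; rewrite -[B2 _]fineK ?hinge_fin_num// -EFinM; congr (_%:E).
    by ring.
  - rewrite (eq_bigr (fun p => (poisson_sub r C p * Num.max (f t0) 0)%:E)); last first.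
      move=> p _; rewrite EFinM; congr (_ * _)%E; rewrite /H3 /densdiff.
      (* Both densities have the same mean, so the distance is 0 and the hinge reduces to its
         coefficient. *)
      rewrite (iint_hinge (Num.max (f t0) 0) 0 sigma0 (s := 0)).
        by rewrite hinge0 subr0 (max_idPl _)// le_max lexx orbT.
      by rewrite big1 ?expr0n// => i _; rewrite subrr mul0r expr0n.
    by rewrite sumEFin -mulr_suml sum_poisson_sub mul1r.
(* The univariate side is written as an iterated integral over the single coordinate [v 0], so that
   the linearity lemmas for [iint] apply. *)
pose G1 (i : 'I_#|gm|.+1) (v : nat -> R) :=
  phi (v 0%N) * Num.max (1 * lratio (i%:R * c) (v 0%N) - a t0 i) 0.
pose G2 (j : 'I_#|gp|.+1) (v : nat -> R) :=
  phi (v 0%N) * Num.max (-1 * lratio (- j%:R * c) (v 0%N) - - b t0 j) 0.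
have cm (F : R -> R) : measurable_fun setT F -> cmeas (fun v => (F (v 0%N))%:E).
  move=> mF d' S tau g _ mg; apply/measurable_EFinP.
  exact: measurableT_comp.
have mG1 i : cmeas (fun v => (G1 i v)%:E).
  exact: (cm (fun t => phi t * _) (measurable_hinge_fun _ _ _)).
have mG2 i : cmeas (fun v => (G2 i v)%:E).
  exact: (cm (fun t => phi t * _) (measurable_hinge_fun _ _ _)).
have G10 i v : 0 <= G1 i v by exact: hinge_fun_ge0.
have G20 i v : 0 <= G2 i v by exact: hinge_fun_ge0.
have k20 (j : 'I_#|gp|.+1) : 0 <= alpha * binomial_pmf #|gp| r j by rewrite mulr_ge0.
have c0 : 0 <= c by rewrite divr_ge0// ltW.
have pt (t : R) : phi t * clipped c r alpha #|gm| #|gp| t0 t =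
    \sum_(i < #|gm|.+1) binomial_pmf #|gm| r i * G1 i (fun=> t) +
    \sum_(j < #|gp|.+1) (alpha * binomial_pmf #|gp| r j) * G2 j (fun=> t) +
    Num.max (f t0) 0 * phi t.
  rewrite /clipped -(excess_comonotone #|gm| #|gp| c0 r01 alpha0 t0 t).
  rewrite !mulrDr !mulr_sumr [phi t * Num.max (f t0) 0]mulrC.
  by congr (_ + _ + _); apply: eq_bigr => i _; rewrite mulrCA.
have -> : (\int[mu]_t (phi t * clipped c r alpha #|gm| #|gp| t0 t)%:E =
    iint 1 (fun v => (\sum_(i < #|gm|.+1) binomial_pmf #|gm| r i * G1 i v)%:E +
      (\sum_(j < #|gp|.+1) (alpha * binomial_pmf #|gp| r j) * G2 j v)%:E +
      (Num.max (f t0) 0)%:E * (phi (v 0%N))%:E))%E.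
  by apply: eq_integral => t _; rewrite pt.
have max0 : 0 <= Num.max (f t0) 0 by rewrite le_max lexx orbT.
have mphi : cmeas (fun v => (phi (v 0%N))%:E) := cm _ measurable_phi.
have m1 := cmeas_wsum (fun i : 'I_#|gm|.+1 => binomial_pmf #|gm| r i) mG1.
have m2 := cmeas_wsum (fun j : 'I_#|gp|.+1 => alpha * binomial_pmf #|gp| r j) mG2.
rewrite iintD.
- rewrite iintD//.
  + rewrite !iint_wsum// iintZl//.
      by rewrite /= integral_normal_pdf mule1.
    by move=> v; rewrite lee_fin phi_ge0.
  + by move=> v; rewrite lee_fin sumr_ge0// => i _; rewrite mulr_ge0.
  + by move=> v; rewrite lee_fin sumr_ge0// => i _; rewrite mulr_ge0.
- by move=> d' S tau g mtau mg; apply: emeasurable_funD;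
    [exact: (m1 d' S tau g)|exact: (m2 d' S tau g)].
- by move=> d' S tau g mtau mg; apply: emeasurable_funM => //; exact: (mphi d' S tau g).
- move=> v; apply: adde_ge0; rewrite lee_fin sumr_ge0// => i _; rewrite mulr_ge0//.
- by move=> v; rewrite mule_ge0// lee_fin phi_ge0.
Qed.

End hockey.

(** * Rescaling of the univariate mixtures *)

Section univariate.
Context {R : realType}.
Local Notation mu := (@lebesgue_measure R).
Local Notation phi := (@normal_pdf R 0 1).

(** The sign [e] is 1 for the first mixture of the bound and -1 for the second. *)
Definition unimix (s : R) (K : nat) (e r : R) (t : R) : R :=
  \sum_(i < K.+1) normal_pdf (e * i%:R) s t * binomial_pmf K r i.

Lemma measurable_unimix s K e r : measurable_fun setT (unimix s K e r).
Proof.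
apply: measurable_sum => i; apply: measurable_funM => //.
exact: measurable_normal_pdf.
Qed.

Lemma unimix_gt0 s K e r t : 0 < s -> 0 <= r <= 1 -> 0 < unimix s K e r t.
Proof.
move=> s0 r01.
have n0 m : 0 < normal_pdf m s t.
  by rewrite normal_pdfE ?gt_eqF// mulr_gt0 ?expR_gt0// normal_peak_gt0 ?gt_eqF.
have t0 (i : 'I_K.+1) : 0 <= normal_pdf (e * i%:R) s t * binomial_pmf K r i.
  by rewrite mulr_ge0 ?(ltW (n0 _))// binomial_pmf_ge0.
rewrite lt_neqAle sumr_ge0// andbT eq_sym; apply/negP => /eqP m0.
suff : \sum_(i < K.+1) binomial_pmf K r i = 0.
  by rewrite sum_binomial_pmf => /eqP; rewrite oner_eq0.
apply: big1 => i _.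
have : normal_pdf (e * i%:R) s t * binomial_pmf K r i = 0.
  exact: (psumr_eq0P _ m0).
by move=> /eqP; rewrite mulf_eq0 gt_eqF ?n0//= => /eqP.
Qed.

Lemma unimix_scale s K e r u : 0 < s ->
  s * unimix s K e r (s * u + 0) =
  phi u * \sum_(i < K.+1) binomial_pmf K r i * lratio (e * i%:R * s^-1) u.
Proof.
move=> s0; rewrite !mulr_sumr; apply: eq_bigr => i _.
by rewrite mulrA density_at// subr0; ring.
Qed.

(** The substitution t = (sigma / L) u standardises the components and turns their unit spacing into
    L / sigma. *)
Lemma integral_univariate (L sigma r alpha : R) (Km Kp : nat) : 0 < L -> 0 < sigma ->
  (\int[mu]_t (phi t * Num.max (excess (L / sigma) r alpha Km Kp t) 0)%:E =
   \int[mu]_t (Num.max (unimix (sigma / L) Km 1 r t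
                        - alpha * unimix (sigma / L) Kp (-1) r t) 0)%:E)%E.
Proof.
move=> L0 sigma0; have s0 : 0 < sigma / L by rewrite divr_gt0.
set s := sigma / L; have sE : L / sigma = s^-1 by rewrite /s invf_div.
have pt (t : R) : phi t * Num.max (excess (L / sigma) r alpha Km Kp t) 0 =
    s * Num.max (unimix s Km 1 r (s * t + 0) - alpha * unimix s Kp (-1) r (s * t + 0)) 0.
  rewrite !maxr_pMr ?phi_ge0 ?(ltW s0)// !mulr0 !mulrBr (mulrCA s).
  rewrite !unimix_scale// /excess sE mulrCA; congr (Num.max (_ - _) _).
    by congr (_ * _); apply: eq_bigr => i _; rewrite mul1r.
  by congr (_ * (_ * _)); apply: eq_bigr => i _; rewrite mulN1r.
rewrite [RHS](@ge0_integral_affine _ s 0) ?gt_eqF//; first last.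
- by move=> t; rewrite lee_fin le_max lexx orbT.
- apply/measurable_EFinP; apply: measurable_maxr => //.
  by apply: measurable_funB; [|apply: measurable_funM => //]; exact: measurable_unimix.
by apply: eq_integral => t _; rewrite pt gtr0_norm.
Qed.
End univariate.

(** * Renyi divergence *)

Section renyi.
Context {R : realType}.
Variable alpha : R.
Hypothesis alpha1 : 1 < alpha.
Local Notation mu := (@lebesgue_measure R).

(** The case p = q = 1 of the mixture formula; being positive and finite, it can be cancelled. *)
Definition renyi_const : \bar R :=
  (\int[mu]_y (expR (- (alpha - 1) * y) * Num.max (1 - expR (- y)) 0)%:E)%E.

Let measurable_weight (p q : R) : measurable_fun setT
  (fun y : R => expR (- (alpha - 1) * y) * Num.max (p - expR (- y) * q) 0).
Proof.
apply: measurable_funM; first by apply: measurableT_comp => //; exact: measurable_funM.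
apply: measurable_maxr => //; apply: measurable_funB => //; apply: measurable_funM => //.
by apply: measurableT_comp => //; exact: measurable_funN.
Qed.

Lemma renyi_const_lty : (renyi_const < +oo)%E.
Proof.
have a0 : 0 < alpha - 1 by rewrite subr_gt0.
(* For [y < 0] the integrand vanishes; for [y >= 0] its second factor is at most 1, leaving a
   multiple of an exponential density. *)
apply: (@le_lt_trans _ _ (\int[mu]_y ((alpha - 1)^-1%:E * (exponential_pdf (alpha - 1) y)%:E))%E).
  apply: ge0_le_integral => //.
  - apply/measurable_EFinP; have := measurable_weight 1 1.
    by under eq_fun do rewrite mulr1.
  - apply: emeasurable_funM => //; apply/measurable_EFinP.
    exact: measurable_exponential_pdf.
  - move=> y _; rewrite -EFinM lee_fin.
    have [y0|y0] := leP 0 y.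
      rewrite exponential_pdfE// mulrA mulVf ?gt_eqF// mul1r.
      by rewrite -[leRHS]mulr1 ler_wpM2l ?expR_ge0// ge_max ler01 gerBl expR_ge0.
    rewrite (max_idPr _) ?mulr0.
      by rewrite mulr_ge0 ?invr_ge0 ?exponential_pdf_ge0 ?(ltW a0).
    by rewrite subr_le0 -expR0 ler_expR oppr_ge0 ltW.
rewrite ge0_integralZl//=.
- by rewrite integral_exponential_pdf// mule1 ltry.
- by apply/measurable_EFinP; exact: measurable_exponential_pdf.
- by move=> y _; rewrite lee_fin exponential_pdf_ge0 ?(ltW a0).
- by rewrite lee_fin invr_ge0 ltW.
Qed.

Lemma renyi_const_gt0 : (0 < renyi_const)%E.
Proof.
have a0 : 0 < alpha - 1 by rewrite subr_gt0.
(* A lower bound of the integrand on [1, 2]: its first factor is least at 2, its second at 1. *)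
pose k := expR (- (alpha - 1) * 2) * (1 - expR (- 1)) : R.
have k0 : 0 < k by rewrite mulr_gt0 ?expR_gt0// subr_gt0 expR_lt1 oppr_lt0.
apply: (@lt_le_trans _ _ (\int[mu]_y (k * \1_`[1, 2] y)%:E)%E).
  under eq_integral do rewrite EFinM.
  rewrite ge0_integralZl//= ?lee_fin ?(ltW k0)//; last first.
    by apply/measurable_EFinP; exact: measurable_indic.
  rewrite integral_indic//= setIT lebesgue_measure_itv/= lte_fin ltr1n/=.
  by rewrite mule_gt0// ?lte_fin// subr_gt0 ltr1n.
apply: ge0_le_integral => //.
- by move=> y _; rewrite lee_fin mulr_ge0// ltW.
- by apply/measurable_EFinP; apply: measurable_funM => //; exact: measurable_indic.
- apply/measurable_EFinP; have := measurable_weight 1 1.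
  by under eq_fun do rewrite mulr1.
- move=> y _; rewrite lee_fin indicE.
  have [|] := boolP (y \in _); last first.
    by rewrite mulr0 mulr_ge0 ?expR_ge0// le_max lexx orbT.
  rewrite inE/= in_itv/= => /andP[y1 y2]; rewrite mulr1.
  apply: ler_pM; rewrite ?expR_ge0//.
  - by rewrite ler_expR !mulNr lerN2 ler_wpM2l ?(ltW a0).
  - by rewrite le_max lerD2l lerN2 ler_expR lerN2 y1.
Qed.

(* [t^alpha] is a mixture of the hinges [(t - e^-y)_+]; shifting [y] by
   [ln (p / q)] shows that the mixing weights do not depend on [p] and [q]. *)
Lemma renyi_mixture (p q : R) : 0 < p -> 0 < q ->
  (\int[mu]_y (expR (- (alpha - 1) * y) * Num.max (p - expR (- y) * q) 0)%:E
   = (powR p alpha * powR q (1 - alpha))%:E * renyi_const)%E.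
Proof.
move=> p0 q0; set tau := ln p - ln q.
rewrite (@ge0_integral_affine _ 1 (- tau)) ?oner_neq0//; first last.
- by move=> y; rewrite lee_fin mulr_ge0 ?expR_ge0// le_max lexx orbT.
- by apply/measurable_EFinP; exact: measurable_weight.
have pt (u : R) : expR (- (alpha - 1) * (1 * u + - tau)) *
      Num.max (p - expR (- (1 * u + - tau)) * q) 0 =
    powR p alpha * powR q (1 - alpha) *
      (expR (- (alpha - 1) * u) * Num.max (1 - expR (- u)) 0).
  have -> : expR (- (1 * u + - tau)) * q = p * expR (- u).
    rewrite -[X in _ * X = _](lnK q0) -[X in _ = X * _](lnK p0) -!expRD /tau.
    by congr expR; ring.
  have -> : p - p * expR (- u) = p * (1 - expR (- u)) by ring.
  rewrite -[X in Num.max _ X](mulr0 p) -maxr_pMr ?(ltW p0)// !mulrA; congr (_ * _).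
  rewrite /powR !gt_eqF// -[X in _ * X = _](lnK p0) -!expRD /tau.
  by congr expR; ring.
rewrite /renyi_const -ge0_integralZl//=.
- by apply: eq_integral => u _; rewrite normr1 mul1e pt EFinM.
- apply/measurable_EFinP; have := measurable_weight 1 1.
  by under eq_fun do rewrite mulr1.
- by rewrite lee_fin mulr_ge0// powR_ge0.
Qed.

Definition hockey_weight (p q : (nat -> R) -> R) (y : R) (v : nat -> R) : \bar R :=
  ((expR (- (alpha - 1) * y))%:E * psi_integrand Hockey (expR (- y)) (p v) (q v))%E.

Lemma hockey_integrand_ge0 a (p q : R) : (0 <= psi_integrand Hockey a p q)%E.
Proof. by rewrite lee_fin le_max lexx orbT. Qed.

Lemma hockey_weight_ge0 p q y v : (0 <= hockey_weight p q y v)%E.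
Proof. by rewrite mule_ge0 ?hockey_integrand_ge0// lee_fin expR_ge0. Qed.

Lemma cmeas_hockey a (p q : (nat -> R) -> R) :
  cmeas (fun v => (p v)%:E) -> cmeas (fun v => (q v)%:E) ->
  cmeas (fun v => psi_integrand Hockey a (p v) (q v)).
Proof.
move=> mp mq d S tau g mtau mg; apply/measurable_EFinP; apply: measurable_maxr => //.
apply: measurable_funB.
  by apply/measurable_EFinP; exact: (mp d S tau g).
apply: measurable_funM => //.
by apply/measurable_EFinP; exact: (mq d S tau g).
Qed.

Lemma coord_measurable_hockey_weight p q :
  cmeas (fun v => (p v)%:E) -> cmeas (fun v => (q v)%:E) ->
  coord_measurable (hockey_weight p q).
Proof.
move=> mp mq d S tau g mtau mg; apply: emeasurable_funM; apply/measurable_EFinP.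
  by apply: measurableT_comp => //; exact: measurable_funM.
apply: measurable_maxr => //; apply: measurable_funB.
  by apply/measurable_EFinP; exact: (mp d S tau g).
apply: measurable_funM; last by apply/measurable_EFinP; exact: (mq d S tau g).
by apply: measurableT_comp => //; exact: measurableT_comp.
Qed.

Lemma renyi_iint n (p q : (nat -> R) -> R) :
  (forall v, 0 < p v) -> (forall v, 0 < q v) ->
  cmeas (fun v => (p v)%:E) -> cmeas (fun v => (q v)%:E) ->
  (renyi_const * iint n (fun v => psi_integrand Renyi alpha (p v) (q v))
   = \int[mu]_y iint n (hockey_weight p q y))%E.
Proof.
move=> p0 q0 mp mq; rewrite -iint_tonelli; first last.
- by move=> y v; exact: hockey_weight_ge0.
- exact: coord_measurable_hockey_weight.
have cf : renyi_const \is a fin_num.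
  by rewrite ge0_fin_numE ?renyi_const_lty// ltW// renyi_const_gt0.
have mR : cmeas (fun v => psi_integrand Renyi alpha (p v) (q v)).
  move=> d S tau g mtau mg; apply/measurable_EFinP; apply: measurable_funM.
    apply: (@measurableT_comp _ _ _ _ _ _ (fun x : R => powR x alpha)) => //.
    by apply/measurable_EFinP; exact: (mp d S tau g).
  apply: (@measurableT_comp _ _ _ _ _ _ (fun x : R => powR x (1 - alpha))) => //.
  by apply/measurable_EFinP; exact: (mq d S tau g).
rewrite -(fineK cf) -iintZl//; first last.
- by move=> v; rewrite lee_fin mulr_ge0// powR_ge0.
- by rewrite fine_ge0// ltW// renyi_const_gt0.
by apply: eq_iint => v; rewrite fineK// muleC -renyi_mixture.
Qed.

(** Times [renyi_const], both sides are integrals over [y] of hockey-stick integrals at level e^-y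
    with the same weight, so the hypothesis applies for each [y]. *)
Lemma renyi_le_of_hockey n n' (p q : (nat -> R) -> R) (p' q' : (nat -> R) -> R) :
  (forall v, 0 < p v) -> (forall v, 0 < q v) ->
  (forall v, 0 < p' v) -> (forall v, 0 < q' v) ->
  cmeas (fun v => (p v)%:E) -> cmeas (fun v => (q v)%:E) ->
  cmeas (fun v => (p' v)%:E) -> cmeas (fun v => (q' v)%:E) ->
  (forall a, 0 <= a ->
    (iint n (fun v => psi_integrand Hockey a (p v) (q v))
     <= iint n' (fun v => psi_integrand Hockey a (p' v) (q' v)))%E) ->
  (iint n (fun v => psi_integrand Renyi alpha (p v) (q v))
   <= iint n' (fun v => psi_integrand Renyi alpha (p' v) (q' v)))%E.
Proof.
move=> p0 q0 p'0 q'0 mp mq mp' mq' H.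
have cf : renyi_const \is a fin_num.
  by rewrite ge0_fin_numE ?renyi_const_lty// ltW// renyi_const_gt0.
rewrite -(lee_pmul2l cf renyi_const_gt0) !renyi_iint//.
apply: ge0_le_integral => //.
- by move=> y _; apply: iint_ge0 => v; exact: hockey_weight_ge0.
- apply: (@measurable_iint _ _ _ R); first exact: coord_measurable_hockey_weight.
  by move=> y v; exact: hockey_weight_ge0.
- apply: (@measurable_iint _ _ _ R); first exact: coord_measurable_hockey_weight.
  by move=> y v; exact: hockey_weight_ge0.
- move=> y _; rewrite /hockey_weight !iintZl ?expR_ge0//; first last.
  + by move=> v; exact: hockey_integrand_ge0.
  + exact: cmeas_hockey.
  + by move=> v; exact: hockey_integrand_ge0.
  + exact: cmeas_hockey.
  by rewrite lee_wpmul2l ?lee_fin ?expR_ge0// H ?expR_ge0.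
Qed.
End renyi.

(** * Conclusion for both divergences *)

Lemma unimix_means {R : realType} (s r : R) (K : nat) :
  unimix s K 1 r = (fun t => \sum_(i < K.+1) normal_pdf i%:R s t * binomial_pmf K r i).
Proof. by apply/funext => t; apply: eq_bigr => i _; rewrite mul1r. Qed.

Lemma unimix_opp_means {R : realType} (s r : R) (K : nat) :
  unimix s K (-1) r = (fun t => \sum_(i < K.+1) normal_pdf (- i%:R) s t * binomial_pmf K r i).
Proof. by apply/funext => t; apply: eq_bigr => i _; rewrite mulN1r. Qed.

Lemma hockey_le_unimix (R : realType) (A : finType) (D : nat)
    (h : {set A} -> 'rV[R]_D) (sigma r alpha : R) (C gm gp : {set A}) :
  0 <= r <= 1 -> 0 < sigma -> 0 < L2sens h -> 0 <= alpha ->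
  [disjoint C & gm] -> [disjoint C & gp] ->
  (iint D (fun v => psi_integrand Hockey alpha
     (mix h sigma r (C :|: gm) v) (mix h sigma r (C :|: gp) v))
   <= iint 1 (fun v => psi_integrand Hockey alpha
        (unimix (sigma / L2sens h) #|gm| 1 r (v 0%N))
        (unimix (sigma / L2sens h) #|gp| (-1) r (v 0%N))))%E.
Proof.
move=> r01 s0 L0 alpha0 Cgm Cgp.
have c0 : 0 <= L2sens h / sigma by rewrite divr_ge0// ltW.
apply: (@le_trans _ _ (\int[lebesgue_measure]_t (normal_pdf 0 1 t *
    Num.max (excess (L2sens h / sigma) r alpha #|gm| #|gp| t) 0)%:E)%E).
  apply: le_excess_integral => // t0.
  exact: iint_mix_diff_le.
by rewrite integral_univariate.
Qed.

Unset Implicit Arguments.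

Theorem theorem3p8 (R : realType) (A : finType) (D : nat)
    (h : {set A} -> 'rV[R]_D) (sigma r alpha : R) (k : divergence)
    (Kp Km : nat) (x x' : {set A}) :
  0 <= r <= 1 ->
  0 < sigma ->
  0 < L2sens h ->
  psi_admissible k alpha ->
  dataset_rel Kp Km x x' ->
  (PsiD k alpha (mix_density h sigma r x) (mix_density h sigma r x')
   <= Psi1 k alpha
        (fun t => (\sum_(i < Km.+1)
           normal_pdf (i%:R) (sigma / L2sens h) t * binomial_pmf Km r i)%R)
        (fun t => (\sum_(j < Kp.+1)
           normal_pdf (- j%:R) (sigma / L2sens h) t * binomial_pmf Kp r j)%R))%E.
Proof.
move=> r01 s0 L0 adm [gm [gp [gmx <- gpx <- ->]]].
set C := x :\: gm.
have xE : x = C :|: gm by rewrite /C finset.setUC finset.setDE finset.setUIr finset.setUCr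
  finset.setIT; apply/esym/finset.setUidPr.
have Cgm : [disjoint C & gm].
  by rewrite -setI_eq0 /C finset.setDE -finset.setIA [_ :&: gm]finset.setIC finset.setICr finset.setI0.
have Cgp : [disjoint C & gp].
  by rewrite disjoint_sym; apply: disjointWr gpx; exact: subsetDl.
rewrite -unimix_means -unimix_opp_means.
rewrite [X in (X <= _)%E](_ : _ = iint D (fun v => psi_integrand k alpha
    (mix h sigma r (C :|: gm) v) (mix h sigma r (C :|: gp) v))); last first.
  by apply: eq_iint => v; rewrite !mixE -xE.
(* Reading the univariate integral as a one-fold [iint] lets [renyi_le_of_hockey] compare dimension
   [D] with dimension 1. *)
rewrite -[X in (_ <= X)%E]/(iint 1 (fun v => psi_integrand k alpha
    (unimix (sigma / L2sens h) #|gm| 1 r (v 0%N))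
    (unimix (sigma / L2sens h) #|gp| (-1) r (v 0%N)))).
have cmix y : cmeas (fun v => (mix h sigma r y v)%:E).
  by move=> d S tau g _ mg; apply/measurable_EFinP; exact: measurable_mix.
have cuni K e : cmeas (fun v => (unimix (sigma / L2sens h) K e r (v 0%N))%:E).
  move=> d S tau g _ mg; apply/measurable_EFinP.
  apply: (measurableT_comp (measurable_unimix _ _ _ _)).
  exact: mg.
case: k adm => adm; first exact: hockey_le_unimix.
apply: (@renyi_le_of_hockey _ alpha adm) => //.
- by move=> v; exact: mix_gt0.
- by move=> v; exact: mix_gt0.
- by move=> v; apply: unimix_gt0 => //; exact: divr_gt0.
- by move=> v; apply: unimix_gt0 => //; exact: divr_gt0.
- by move=> a a0; exact: hockey_le_unimix.
Qed.
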